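(* Let $n>75$ be even. 1. If $S_{2n+2}$ is a Steiner quadruple system of order $2n+2$ and $B_n$ is a $3$-BBD$(n)$, then there exists a Steiner quadruple system $S_{8n+2}$ of order $8n+2$ containing both $S_{2n+2}$ and $B_n$ (i.e. there are injections of the point sets of $S_{2n+2}$ and of $B_n$ into the point set of $S_{8n+2}$ mapping every block of $S_{2n+2}$ and every block of $B_n$ onto a block of $S_{8n+2}$). 2. If $S_{2n+2}\in S(3,\{4,6\},2n+2)$ and $B_n$ is a $3$-BBD$(n)$, then there exists $S_{8n+2}\in S(3,\{4,6\},8n+2)$ containing both $S_{2n+2}$ and $B_n$ in the same sense.
   Context: A Steiner quadruple system of order $v$ (an element of $S(3,4,v)$) is a set of $4$-element subsets (blocks) of a $v$-element set $X$ such that every $3$-element subset of $X$ lies in exactly one block. $S(3,\{4,6\},v)$ denotes the set of $3$-wise balanced designs on a $v$-element set $X$ with all blocks of size $4$ or $6$, i.e. collections of $4$- and $6$-element subsets of $X$ such that every $3$-element subset of $X$ lies in exactly one block. A $3$-BBD$(n)$ is a triple $(X,\{g_1,g_2\},B)$ with $|X|=n$, $\{g_1,g_2\}$ a partition of $X$ into two equal parts, $B$ a set of $4$-subsets of $X$ each meeting $g_1$ and $g_2$ in exactly two points, such that every $3$-subset of $X$ meeting both $g_1$ and $g_2$ lies in exactly one block. *)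

(* Defs.v *)
From mathcomp Require Import all_boot.
Set Implicit Arguments. Unset Strict Implicit. Unset Printing Implicit Defensive.

Definition three_wise_once (T : finType) (B : {set {set T}}) : Prop :=
  forall t : {set T}, #|t| = 3 -> #|[set b in B | t \subset b]| = 1.

Definition is_SQS (v : nat) (B : {set {set 'I_v}}) : Prop :=
  (forall b, b \in B -> #|b| = 4) /\ three_wise_once B.

Definition is_S346 (v : nat) (B : {set {set 'I_v}}) : Prop :=
  (forall b, b \in B -> #|b| = 4 \/ #|b| = 6) /\ three_wise_once B.

Definition is_3BBD (n : nat) (g1 : {set 'I_n}) (B : {set {set 'I_n}}) : Prop :=
  let g2 := ~: g1 in
  #|g1| = #|g2| /\
  (forall b, b \in B -> #|b| = 4 /\ #|b :&: g1| = 2 /\ #|b :&: g2| = 2) /\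
  (forall t : {set 'I_n}, #|t| = 3 -> t :&: g1 != set0 -> t :&: g2 != set0 ->
     #|[set b in B | t \subset b]| = 1).

Definition embeds (T T' : finType) (B : {set {set T}}) (B' : {set {set T'}}) : Prop :=
  exists f : T -> T', injective f /\ forall b, b \in B -> f @: b \in B'.

(* Main.v *)
Require Import Defs.
From mathcomp Require Import all_boot.
From HB Require Import structures.
From mathcomp Require Import all_algebra.

(* Take two points at infinity and four groups of 2n points, each group split into two classes
   identified with a set K of size n, and put a copy of S_{2n+2} on each group with infinity.
   Triples inside two classes of different groups are covered by a 3-BBD(2n) obtained by
   doubling B_n. The triples with three distinct classes are covered by inflating a Steiner
   quadruple system of order 10 with two points at infinity and four groups of size 2: it has no
   block meeting all four groups, so it can be inflated along Latin squares on the triples of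
   groups, its blocks covering just the "hole" triples. All other triples are covered by
   quadruples from near cubes: sets N of words in K^4 such that on each three coordinates every
   triple outside a Latin square extends to exactly one word of N, and no triple of the Latin
   square does. Near cubes of order n exist whenever 4 divides n, which the existence of B_n
   forces: take an MDS code of dimension 3 minus an MDS subcode of dimension 2 (orders 4, 8, 9 and
   those coprime to 6), use a product construction, and for order 3 the words in which two symbols
   occur twice each. *)

Set Implicit Arguments. Unset Strict Implicit. Unset Printing Implicit Defensive.
Import GRing.Theory.

(** * Near cubes *)

Lemma card_bij (A B : finType) : #|A| = #|B| -> exists f : A -> B, bijective f.
Proof.
move=> e; exists (fun x => enum_val (cast_ord e (enum_rank x))).
exists (fun x => enum_val (cast_ord (esym e) (enum_rank x))) => x;
by rewrite enum_valK ?cast_ordK ?cast_ordKV enum_rankK.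
Qed.

Definition eqoff (I W : finType) (i : I) (x y : {ffun I -> W}) : Prop :=
  forall j, j != i -> x j = y j.

Definition upd (I W : finType) (i : I) (v : W) (x : {ffun I -> W}) : {ffun I -> W} :=
  [ffun j => if j == i then v else x j].

Lemma upd_off (I W : finType) (i : I) (v : W) (x : {ffun I -> W}) :
  eqoff i x (upd i v x).
Proof. by move=> j nji; rewrite ffunE (negbTE nji). Qed.

Lemma eqoff_sym (I W : finType) (i : I) (x y : {ffun I -> W}) :
  eqoff i x y -> eqoff i y x.
Proof. by move=> h j /h. Qed.

Lemma eqoff_trans (I W : finType) (i : I) (x y z : {ffun I -> W}) :
  eqoff i x y -> eqoff i y z -> eqoff i x z.
Proof. by move=> h h' j nji; rewrite h ?h'. Qed.

Lemma eqoff_eq (I W : finType) (i : I) (x y : {ffun I -> W}) :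
  eqoff i x y -> x i = y i -> x = y.
Proof. by move=> h e; apply/ffunP => j; case: (eqVneq j i) => [->|/h]. Qed.

(** An MDS code of minimum distance 2, stated symmetrically in all coordinates; over four
    coordinates it is the graph of a Latin cube. *)
Definition cube (I K : finType) (Q : {set {ffun I -> K}}) : Prop :=
  (forall i x, exists2 y, y \in Q & eqoff i x y) /\
  (forall i x y, x \in Q -> y \in Q -> eqoff i x y -> x = y).

(* A word lies in [D i] when its restriction to the coordinates other than [i] is a hole; the
   holes of each face form a Latin square, and every other triple of a face extends to a unique
   word of [N]. *)
Record near_cube (K : finType) (Q N : {set {ffun 'I_4 -> K}})
    (D : 'I_4 -> {set {ffun 'I_4 -> K}}) : Prop := NearCube {
  nc_cube : cube Q;
  nc_ext : forall i x, x \notin D i -> exists2 y, y \in N & eqoff i x y;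
  nc_uniq : forall i x y, x \in N -> y \in N -> eqoff i x y -> x = y;
  nc_hole : forall i x, x \in N -> x \notin D i;
  nc_off : forall i x y, eqoff i x y -> x \in D i -> y \in D i;
  nc_latin : forall i j x, j != i -> exists2 y, y \in D i & eqoff j x y;
  nc_latin_uniq : forall i j x y, j != i -> x \in D i -> y \in D i ->
    eqoff j x y -> x j = y j }.

(** Quantified over all alphabets of size [n], so that it applies to any point type; [nc_transfer]
    derives it from a single alphabet. *)
Definition has_nc (n : nat) : Prop :=
  forall K : finType, #|K| = n -> exists Q N D, @near_cube K Q N D.

(** [M] is an MDS code of length 4 and dimension 3; the last two clauses make [D] a subcode of
    dimension 2, in other words a pair of orthogonal Latin squares. *)
Definition mds_pair (K : finType) (M D : {set {ffun 'I_4 -> K}}) : Prop :=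
  [/\ cube M, D \subset M,
      forall i j x, i != j -> exists2 y, y \in D & y i = x i /\ y j = x j &
      forall i j x y, i != j -> x \in D -> y \in D -> x i = y i -> x j = y j -> x = y].

Definition has_mds (n : nat) : Prop :=
  exists2 K : finType, #|K| = n & exists M D, @mds_pair K M D.

Lemma two_others (i j : 'I_4) : i != j ->
  exists k l : 'I_4, [/\ k != l, k != i, k != j, l != i & l != j] /\
    forall h, h != i -> h != j -> h = k \/ h = l.
Proof.
move=> nij; have: #|~: [set i; j]| == 2.
  by rewrite -(eqn_add2l #|[set i; j]|) cardsC card_ord cards2 nij.
move/cards2P=> [k [l [nkl e]]].
have inE' h : (h != i) && (h != j) = (h == k) || (h == l).
  by rewrite -negb_or -in_set2 -in_setC e in_set2.
exists k, l; split.
  by have := inE' k; have := inE' l; rewrite !eqxx orbT /= => /andP[-> ->] /andP[-> ->].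
move=> h hi hj; have := inE' h; rewrite hi hj => /esym/orP[]/eqP->; by [left|right].
Qed.

(** The code [D] punctured at [i], kept as a set of full words whose entry at [i] is free. *)
Definition shadow (I K : finType) (D : {set {ffun I -> K}}) (i : I) : {set {ffun I -> K}} :=
  [set x | [exists v, upd i v x \in D]].

Lemma shadowP (I K : finType) (D : {set {ffun I -> K}}) i x :
  reflect (exists2 y, y \in D & eqoff i x y) (x \in shadow D i).
Proof.
rewrite inE; apply: (iffP existsP) => [[v vD]|[y yD exy]].
  by exists (upd i v x) => //; exact: upd_off.
exists (y i); suff -> : upd i (y i) x = y by [].
by apply/ffunP=> j; rewrite ffunE; case: eqVneq => [->|/exy].
Qed.

(** For [i != j] the two remaining coordinates determine a word of [D], hence its entry at [j]; so
    each punctured code is a Latin square. *)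
Lemma shadow_latin (K : finType) (M D : {set {ffun 'I_4 -> K}}) : mds_pair M D ->
  (forall i x y, eqoff i x y -> x \in shadow D i -> y \in shadow D i) /\
  (forall i j x, j != i -> exists2 y, y \in shadow D i & eqoff j x y) /\
  (forall i j x y, j != i -> x \in shadow D i -> y \in shadow D i ->
    eqoff j x y -> x j = y j).
Proof.
case=> _ _ De Du; split; [|split].
- move=> i x y exy /shadowP[z zD exz]; apply/shadowP; exists z => //.
  exact: eqoff_trans (eqoff_sym exy) exz.
- move=> i j x nji; have [k [l [[nkl ki kj li lj] kl]]] := two_others nji.
  have [y yD [yk yl]] := De k l x nkl.
  exists (upd i (x i) y); first by apply/shadowP; exists y => //; apply/eqoff_sym/upd_off.
  move=> h nhj; rewrite ffunE; case: eqVneq => [->//|nhi].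
  by case: (kl h) => // ->.
- move=> i j x y nji /shadowP[x' x'D exx'] /shadowP[y' y'D eyy'] exy.
  have [k [l [[nkl ki kj li lj] _]]] := two_others nji.
  suff e : x' = y' by rewrite exx' // eyy' // e.
  by apply: (Du k l) => //; rewrite -exx' // -eyy' // exy.
Qed.

(** A triple on a face has one extension in [M]. Deleting [D] destroys it exactly for the triples
    that come from [D], so the shadows of [D] are the holes. *)
Lemma mds_nc (K : finType) (M D : {set {ffun 'I_4 -> K}}) :
  mds_pair M D -> near_cube M (M :\: D) (shadow D).
Proof.
move=> md; have [no [nl nlu]] := shadow_latin md; case: md => -[Me Mu] /subsetP sDM _ _.
split=> //.
- move=> i x nx; have [y yM exy] := Me i x; exists y => //.
  by rewrite inE yM andbT; apply: contra nx => yD; apply/shadowP; exists y.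
- by move=> i x y /setDP[xM _] /setDP[yM _]; exact: Mu.
- move=> i x /setDP[xM nxD]; apply: contra nxD => /shadowP[y yD exy].
  by rewrite (Mu i x y) // sDM.
Qed.

Lemma nc_transfer (n : nat) (K : finType) (Q N : {set {ffun 'I_4 -> K}}) D :
  #|K| = n -> near_cube Q N D -> has_nc n.
Proof.
move=> cK nc K' cK'.
have [f [g fK gK]] : exists f : K' -> K, bijective f by apply: card_bij; rewrite cK cK'.
pose F (x : {ffun 'I_4 -> K'}) : {ffun 'I_4 -> K} := [ffun i => f (x i)].
pose G (x : {ffun 'I_4 -> K}) : {ffun 'I_4 -> K'} := [ffun i => g (x i)].
have FK : cancel F G by move=> x; apply/ffunP=> i; rewrite !ffunE fK.
have GK : cancel G F by move=> x; apply/ffunP=> i; rewrite !ffunE gK.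
have offF i x y : eqoff i x y -> eqoff i (F x) (F y).
  by move=> h j nji; rewrite !ffunE h.
have offG i x y : eqoff i (F x) y -> eqoff i x (G y).
  by move=> h j nji; rewrite !ffunE -h // ffunE fK.
case: nc => [[Qe Qu] ne nu nh no nl nlu].
exists (F @^-1: Q), (F @^-1: N), (fun i => F @^-1: D i); split; first split.
- move=> i x; have [y yQ e] := Qe i (F x).
  by exists (G y); rewrite ?inE ?GK //; exact: offG.
- by move=> i x y; rewrite !inE => xQ yQ /offF e; apply: (can_inj FK); exact: Qu e.
- move=> i x; rewrite inE => /ne[y yN e].
  by exists (G y); rewrite ?inE ?GK //; exact: offG.
- by move=> i x y; rewrite !inE => xQ yQ /offF e; apply: (can_inj FK); exact: nu e.
- by move=> i x; rewrite !inE; exact: nh.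
- by move=> i x y; rewrite !inE => /offF; exact: no.
- move=> i j x nji; have [y yN e] := nl i j (F x) nji.
  by exists (G y); rewrite ?inE ?GK //; exact: offG.
- move=> i j x y nji; rewrite !inE => xD yD /offF e; apply: (can_inj fK).
  by have := nlu i j _ _ nji xD yD e; rewrite !ffunE.
Qed.

Lemma mds_has_nc (n : nat) : has_mds n -> has_nc n.
Proof. by case=> K cK [M [D /mds_nc]]; exact: nc_transfer. Qed.

(** The first component runs over [M]; the second runs over [N] when the first lies in [D1], and
    over the full cube [Q] otherwise. Extending a triple fixes the first component, which decides
    the code completing the second. A hole thus arises only when both components are holes, and the
    holes form products of Latin squares. *)
Lemma nc_prod (a b : nat) : has_mds a -> has_nc b -> has_nc (a * b).
Proof.
case=> K1 c1 [M [D1 md]] hb.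
have [Q [N [D2 [[Qe Qu] ne nu nh no nl nlu]]]] := hb 'I_b (card_ord b).
have [no1 [nl1 nlu1]] := shadow_latin md; case: md => -[Me Mu] /subsetP sDM _ _.
pose p1 (x : {ffun 'I_4 -> K1 * 'I_b}) : {ffun 'I_4 -> K1} := [ffun i => (x i).1].
pose p2 (x : {ffun 'I_4 -> K1 * 'I_b}) : {ffun 'I_4 -> 'I_b} := [ffun i => (x i).2].
pose pr (x : {ffun 'I_4 -> K1}) (y : {ffun 'I_4 -> 'I_b}) := [ffun i => (x i, y i)].
have p1K x y : p1 (pr x y) = x by apply/ffunP=> i; rewrite !ffunE.
have p2K x y : p2 (pr x y) = y by apply/ffunP=> i; rewrite !ffunE.
have off1 i x y : eqoff i x y -> eqoff i (p1 x) (p1 y).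
  by move=> e j /e exy; rewrite !ffunE exy.
have off2 i x y : eqoff i x y -> eqoff i (p2 x) (p2 y).
  by move=> e j /e exy; rewrite !ffunE exy.
have offp i x y1 y2 : eqoff i (p1 x) y1 -> eqoff i (p2 x) y2 -> eqoff i x (pr y1 y2).
  by move=> e1 e2 j nji; rewrite !ffunE -e1 // -e2 // !ffunE -surjective_pairing.
have pinj x y : p1 x = p1 y -> p2 x = p2 y -> x = y.
  move=> /ffunP e1 /ffunP e2; apply/ffunP=> j; have := e1 j; have := e2 j.
  by rewrite !ffunE; case: (x j) (y j) => [? ?] [? ?] /= -> ->.
pose QQ := [set x | (p1 x \in M) && (p2 x \in Q)].
pose NN := [set x | (p1 x \in M) && (p2 x \in if p1 x \in D1 then N else Q)].
pose DD i := [set x | (p1 x \in shadow D1 i) && (p2 x \in D2 i)].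
have QE x : (x \in QQ) = (p1 x \in M) && (p2 x \in Q) by rewrite in_set.
have NE x : (x \in NN) = (p1 x \in M) && (p2 x \in if p1 x \in D1 then N else Q) by rewrite in_set.
have DE i x : (x \in DD i) = (p1 x \in shadow D1 i) && (p2 x \in D2 i) by rewrite in_set.
pose E := (QE, NE, DE).
apply: (@nc_transfer _ (K1 * 'I_b)%type QQ NN DD); first by rewrite card_prod c1 card_ord.
split; first split.
- move=> i x; have [y yM e1] := Me i (p1 x); have [z zQ e2] := Qe i (p2 x).
  by exists (pr y z); [rewrite E p1K p2K yM | exact: offp].
- move=> i x y; rewrite !E => /andP[x1 x2] /andP[y1 y2] e; apply: pinj.
    exact: Mu (off1 _ _ _ e).
  exact: Qu (off2 _ _ _ e).
- move=> i x; rewrite E negb_and => nx.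
  have [y yM e1] := Me i (p1 x).
  have [yD|nyD] := boolP (y \in D1).
    have sx : p1 x \in shadow D1 i by apply/shadowP; exists y.
    rewrite sx /= in nx; have [z zN e2] := ne i _ nx.
    by exists (pr y z); [rewrite E p1K p2K yM yD | exact: offp].
  have [z zQ e2] := Qe i (p2 x).
  by exists (pr y z); [rewrite E p1K p2K yM (negbTE nyD) | exact: offp].
- move=> i x y; rewrite !E => /andP[x1 x2] /andP[y1 y2] e.
  have e1 : p1 x = p1 y by exact: Mu (off1 _ _ _ e).
  apply: pinj => //; move: x2 y2; rewrite e1; case: ifP => _ x2 y2.
    exact: nu (off2 _ _ _ e).
  exact: Qu (off2 _ _ _ e).
- move=> i x; rewrite !E => /andP[xM]; case: ifPn => xD xN.
    by rewrite negb_and (nh i _ xN) orbT.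
  rewrite negb_and; apply/orP; left; apply: contra xD => /shadowP[y yD exy].
  by rewrite (Mu i (p1 x) y) // sDM.
- move=> i x y e; rewrite !E => /andP[x1 x2].
  by rewrite (no1 _ _ _ (off1 _ _ _ e) x1) (no _ _ _ (off2 _ _ _ e) x2).
- move=> i j x nji; have [y yD e1] := nl1 i j (p1 x) nji; have [z zD e2] := nl i j (p2 x) nji.
  by exists (pr y z); [rewrite E p1K p2K yD | exact: offp].
- move=> i j x y nji; rewrite !E => /andP[x1 x2] /andP[y1 y2] e.
  have := nlu1 i j _ _ nji x1 y1 (off1 _ _ _ e); have := nlu i j _ _ nji x2 y2 (off2 _ _ _ e).
  by rewrite !ffunE; case: (x j) (y j) => [? ?] [? ?] /= -> ->.
Qed.

(** * Linear MDS codes and the orders of near cubes *)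

Local Open Scope ring_scope.

Definition zero_sum (I : finType) (K : finZmodType) : {set {ffun I -> K}} :=
  [set x : {ffun I -> K} | \sum_i x i == 0].

Lemma zero_sum_cube (I : finType) (K : finZmodType) : cube (zero_sum I K).
Proof.
split=> [i x|i x y].
  exists (upd i (- \sum_(j | j != i) x j) x); last exact: upd_off.
  rewrite inE (bigD1 i) //= ffunE eqxx.
  by rewrite addr_eq0 eqr_opp; apply/eqP/eq_bigr => j nji; rewrite -upd_off.
rewrite !inE (bigD1 i) //= (bigD1 (F := y) i) //= => /eqP x0 /eqP y0 e.
have S : \sum_(j | j != i) x j = \sum_(j | j != i) y j by apply: eq_bigr => j; exact: e.
by apply: eqoff_eq (e) _; apply: (addIr (\sum_(j | j != i) x j)); rewrite x0 S y0.
Qed.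

(** Products of finite abelian groups serve as alphabets of order 4, 8 and 9, and later as the set
    [K]. *)
HB.instance Definition _ (A B : finZmodType) := GRing.Zmodule.on (A * B)%type.

(** The words of the subcode are [g], [h], [al g + be h] and minus the sum of these, hence zero-sum.
    The first two entries determine [(g, h)] trivially; the five kernel conditions are what the
    other five pairs of coordinates require. *)
Lemma linear_mds (K : finZmodType) (al be : K -> K) :
  {morph al : x y / x - y} -> {morph be : x y / x - y} ->
  (forall z, al z = 0 -> z = 0) -> (forall z, be z = 0 -> z = 0) ->
  (forall z, z + al z = 0 -> z = 0) -> (forall z, z + be z = 0 -> z = 0) ->
  (forall z, al z = be z -> z = 0) -> has_mds #|K|.
Proof.
move=> alB beB al0 be0 al1 be1 albe.
have a0 : al 0 = 0 by rewrite -{1}(subrr 0) alB subrr.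
have b0 : be 0 = 0 by rewrite -{1}(subrr 0) beB subrr.
have aN x : al (- x) = - al x by rewrite -sub0r alB a0 sub0r.
have bN x : be (- x) = - be x by rewrite -sub0r beB b0 sub0r.
exists K => //.
pose c (i : 'I_4) (g h : K) : K := nth 0 [:: g; h; al g + be h; - (g + h + (al g + be h))] i.
pose C (g : K * K) : {ffun 'I_4 -> K} := [ffun i => c i g.1 g.2].
have sB (x y z t : K) : x - y + (z - t) = x + z - (y + t) by rewrite opprD addrACA.
have cB i g g' h h' : c i (g - g') (h - h') = c i g h - c i g' h'.
  case: i => [[|[|[|[|//]]]] ?] //=; rewrite /c /= !(alB, beB) !sB //.
  by rewrite opprB opprK addrC.
have c0 i j g h : i != j -> c i g h = 0 -> c j g h = 0 -> g = 0 /\ h = 0.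
  wlog ij : i j / (i < j)%N.
    move=> W nij ci cj; have := nij; rewrite -val_eqE neq_ltn => /orP[] lij; first exact: (W i j).
    by apply: (W j i) => //; rewrite eq_sym.
  move=> _.
  have nz (x : K) : - x = 0 -> x = 0 by move/eqP; rewrite oppr_eq0 => /eqP.
  case: i j ij => [[|[|[|[|//]]]] ?] [[|[|[|[|//]]]] ?] //= _; rewrite /c /=.
  - by move=> ->; rewrite a0 add0r => /be0.
  - by move=> -> /nz; rewrite a0 !add0r => /be1.
  - by move=> ->; rewrite b0 addr0 => /al0.
  - by move=> -> /nz; rewrite b0 !addr0 => /al1.
  - move=> e /nz; rewrite e addr0 => /eqP; rewrite addr_eq0 => /eqP gh; move: e.
    rewrite gh aN addrC => /eqP; rewrite subr_eq0 => /eqP/esym/albe h0.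
    by rewrite h0 oppr0.
(* An injective self-map of the finite set [K * K] is bijective; its inverse supplies the word with
   two prescribed entries. *)
have Cinj i j : i != j -> injective (fun g : K * K => (C g i, C g j)).
  move=> nij [g h] [g' h']; rewrite !ffunE => -[ei ej].
  have [] := c0 i j (g - g') (h - h') nij; rewrite ?cB ?ei ?ej ?subrr //.
  by move=> /eqP; rewrite subr_eq0 => /eqP-> /eqP; rewrite subr_eq0 => /eqP->.
have [Me Mu] := zero_sum_cube 'I_4 K.
exists (zero_sum 'I_4 K), [set C g | g : K * K]; split.
- exact: zero_sum_cube.
- apply/subsetP=> _ /imsetP[[g h] _ ->]; rewrite inE !big_ord_recl big_ord0 !ffunE /c /=.
  by rewrite addr0 !addrA subrr.
- move=> i j x nij; have [inv _ invK] := injF_bij (Cinj i j nij).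
  exists (C (inv (x i, x j))); first exact: imset_f.
  by have := invK (x i, x j) => -[].
- move=> i j _ _ nij /imsetP[g _ ->] /imsetP[h _ ->] ei ej; congr (C _).
  by apply: (Cinj i j nij); rewrite ei ej.
Qed.

(** For multiplication by 1 and by 2, the kernel conditions reduce to the injectivity of
    multiplication by 2 and by 3 modulo [u]. *)
Lemma mds_coprime6 (u : nat) : coprime u 6 -> has_mds u.
Proof.
case: u => [//|u] cu; rewrite -(card_ord u.+1).
have k0 k (z : 'I_u.+1) : coprime u.+1 k -> z *+ k = 0 -> z = 0.
  (* Bezout writes a multiple of [u.+1] as a multiple of [k] plus 1, and both multiples kill [z]. *)
  move=> ck zk; have [[|c] d e _] := egcdnP k (ltn0Sn u).
    by move: e; rewrite (eqP ck) mul0n addn1.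
  have zu : z *+ u.+1 = 0 by apply: val_inj; rewrite Zp_mulrn /= modnMl.
  have : z *+ (c.+1 * u.+1) = 0 by rewrite mulnC mulrnA zu mul0rn.
  by rewrite e (eqP ck) mulrnDr mulr1n mulnC mulrnA zk mul0rn add0r.
have [c2 c3] : coprime u.+1 2 /\ coprime u.+1 3.
  by move: cu; rewrite (_ : 6 = 2 * 3)%N // coprimeMr => /andP.
apply: (@linear_mds _ id (fun z => z *+ 2)) => //=.
- by move=> x y; rewrite mulrnBl.
- by move=> z; exact: k0.
- by move=> z; rewrite -mulr2n; exact: k0.
- by move=> z; rewrite -mulrS; exact: k0.
- by move=> z; rewrite mulr2n -{1}(addr0 z) => /addrI.
Qed.

(** The field with four elements, [w ^ 2 = w + 1]: the maps are multiplication by [w] and by [w ^ 2]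
    in the basis 1, [w]. *)
Lemma has_mds4 : has_mds 4.
Proof.
rewrite (_ : 4 = #|{: 'I_2 * 'I_2}|)%N; last by rewrite card_prod !card_ord.
apply: (@linear_mds _ (fun z => (z.2, z.1 + z.2)) (fun z => (z.1 + z.2, z.1))) => //=.
- by move=> x y; apply: (congr2 pair) => //=; rewrite opprD addrACA.
- by move=> x y; apply: (congr2 pair) => //=; rewrite opprD addrACA.
all: by case=> [[[|[|//]] ?] [[|[|//]] ?]] /(congr1 (fun z => (val z.1, val z.2))) // _;
  congr (_, _); apply: val_inj.
Qed.

(** The field with eight elements, [w ^ 3 = w + 1]: multiplication by [w] and by [w ^ 2] in the
    basis 1, [w], [w ^ 2]. *)
Lemma has_mds8 : has_mds 8.
Proof.
rewrite (_ : 8 = #|{: 'I_2 * 'I_2 * 'I_2}|)%N; last by rewrite !card_prod !card_ord.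
apply: (@linear_mds _ (fun z => (z.2, z.1.1 + z.2, z.1.2)) (fun z =>
  (z.1.2, z.1.2 + z.2, z.1.1 + z.2))) => //=.
- by move=> x y; apply: (congr2 pair); [apply: (congr2 pair)|] => //=; rewrite opprD addrACA.
- by move=> x y; apply: (congr2 pair) => /=; [apply: (congr2 pair)|] => //=; rewrite opprD addrACA.
all: by case=> [[[[|[|//]] ?] [[|[|//]] ?]] [[|[|//]] ?]] /(congr1 (fun z =>
  (val z.1.1, val z.1.2, val z.2))) // _; congr (_, _, _); apply: val_inj.
Qed.

(** The field with nine elements: the identity and multiplication by a square root of -1. *)
Lemma has_mds9 : has_mds 9.
Proof.
rewrite (_ : 9 = #|{: 'I_3 * 'I_3}|)%N; last by rewrite card_prod !card_ord.
apply: (@linear_mds _ id (fun z => (- z.2, z.1))) => //=.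
- by move=> x y; apply: (congr2 pair) => //=; rewrite opprD.
all: by case=> [[[|[|[|//]]] ?] [[|[|[|//]]] ?]] /(congr1 (fun z => (val z.1, val z.2))) // _;
  congr (_, _); apply: val_inj.
Qed.

Definition off_sum (x : {ffun 'I_4 -> 'I_3}) (i : 'I_4) : 'I_3 := \sum_(j | j != i) x j.

Lemma ord4_uniq (h i j k l : 'I_4) : uniq [:: i; j; k; l] -> h \in [:: i; j; k; l].
Proof.
move=> u; apply: contraTT (max_card (mem [:: h; i; j; k; l])) => nh.
have/card_uniqP-> : uniq [:: h; i; j; k; l] by rewrite cons_uniq nh.
by rewrite card_ord.
Qed.

Lemma off_sumE (i j k l : 'I_4) : uniq [:: i; j; k; l] ->
  forall x, off_sum x i = x j + x k + x l.
Proof.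
move=> u; move: (u); rewrite /= !inE !negb_or => /and4P[/and3P[ij ik il] /andP[jk jl] kl _] x.
rewrite /off_sum (bigD1 j) 1?eq_sym //= (bigD1 k) /=; last by rewrite !(eq_sym k) ik jk.
rewrite (bigD1 l) /=; last by rewrite !(eq_sym l) il jl kl.
rewrite big_pred0 ?addr0 ?addrA // => h.
have := ord4_uniq h u; rewrite !inE; do 3 case: eqP => //=; do ?case: eqP => //=.
Qed.

Lemma four_ord (i : 'I_4) : exists j k l, uniq [:: i; j; k; l].
Proof.
have [j nji] : exists j, j != i.
  have: (0 < #|predC1 i|)%N by rewrite cardC1 card_ord.
  by case/card_gt0P=> j; exists j.
have [k [l [[kl kj ki lj li] _]]] := two_others nji.
by exists j, k, l; rewrite /= !inE !negb_or -(eq_sym j i) -(eq_sym k i) -(eq_sym l i)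
  -(eq_sym k j) -(eq_sym l j) nji ki li kj lj kl.
Qed.

(* [N] consists of the words in which two symbols occur twice each. *)
Lemma has_nc3 : has_nc 3.
Proof.
pose N := [set x : {ffun 'I_4 -> 'I_3} | [forall i, off_sum x i != 0]].
pose D i := [set x : {ffun 'I_4 -> 'I_3} | off_sum x i == 0].
have off i x y : eqoff i x y -> off_sum x i = off_sum y i by move=> e; apply: eq_bigr.
have NE i j k l x : uniq [:: i; j; k; l] -> (x \in N) =
    [&& x j + x k + x l != 0, x i + x k + x l != 0, x i + x j + x l != 0 & x i + x j + x k != 0].
  move=> u; rewrite inE.
  have [uj uk ul] : [/\ uniq [:: j; i; k; l], uniq [:: k; i; j; l] & uniq [:: l; i; j; k]].
    by move: u; rewrite /= !inE !negb_or (eq_sym j i) (eq_sym k i) (eq_sym l i)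
      (eq_sym k j) (eq_sym l j) (eq_sym l k) => /and4P[/and3P[-> -> ->] /andP[-> ->] -> _].
  rewrite -(off_sumE u) -(off_sumE uj) -(off_sumE uk) -(off_sumE ul).
  apply/forallP/and4P => [h|[? ? ? ?] h]; first by split.
  have: h \in [:: i; j; k; l].
    by have := ord4_uniq h u.
  by rewrite !inE => /or4P[]/eqP->.
(* Modulo 3, a triple has nonzero sum exactly when two entries agree and the third differs; the only
   completion repeats the odd one out. *)
have key (a b c : 'I_3) : a + b + c != 0 ->
  exists v : 'I_3, forall w, [&& w + b + c != 0, w + a + c != 0 & w + a + b != 0] = (w == v).
  move=> s0; exists (if a == b then c else if a == c then b else a) => w; move: s0.
  by case: a => [[|[|[|//]]] ?]; case: b => [[|[|[|//]]] ?]; case: c => [[|[|[|//]]] ?];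
     case: w => [[|[|[|//]]] ?].
apply: (@nc_transfer _ 'I_3 (zero_sum 'I_4 _) N D); first by rewrite card_ord.
split.
- exact: zero_sum_cube.
- move=> i x; have [j [k [l u]]] := four_ord i; rewrite inE (off_sumE u) => s0.
  have [v vP] := key _ _ _ s0; exists (upd i v x); last exact: upd_off.
  have [ij [ik il]] : j != i /\ k != i /\ l != i.
    by move: u; rewrite /= !inE !negb_or -!andbA !(eq_sym i) => /and4P[-> -> -> _].
  have e := @upd_off _ _ i v x.
  by rewrite (NE _ _ _ _ _ u) -(e j) // -(e k) // -(e l) // s0 ffunE eqxx vP eqxx.
- move=> i x y xN yN e; have [j [k [l u]]] := four_ord i.
  have [ij [ik il]] : j != i /\ k != i /\ l != i.
    by move: u; rewrite /= !inE !negb_or -!andbA !(eq_sym i) => /and4P[-> -> -> _].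
  move: xN yN; rewrite !(NE _ _ _ _ _ u) -(e j) // -(e k) // -(e l) // => /andP[/key[v vP]].
  by rewrite vP => /eqP ex /andP[_]; rewrite vP => /eqP ey; apply: eqoff_eq e _; rewrite ex.
- by move=> i x; rewrite !inE => /forallP.
- by move=> i x y e; rewrite !inE (off _ _ _ e).
- move=> i j x nji; pose v := x j - off_sum x i; exists (upd j v x); last exact: upd_off.
  rewrite inE /off_sum (bigD1 j) //= ffunE eqxx.
  rewrite (eq_bigr x) => [|h /andP[_ nhj]]; last by rewrite -upd_off.
  by rewrite /v /off_sum (bigD1 j) //= opprD addrA subrr add0r addNr.
move=> i j x y nji; rewrite !inE /off_sum (bigD1 j) //= (bigD1 (F := y) j) //= => /eqP x0 /eqP y0 e.
have S : \sum_(h | (h != i) && (h != j)) x h = \sum_(h | (h != i) && (h != j)) y h.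
  by apply: eq_bigr => h /andP[_]; exact: e.
by apply: (addIr (\sum_(h | (h != i) && (h != j)) x h)); rewrite x0 S y0.
Qed.

(** Factors 4 are split off while 16 divides [n], then factors 9. What remains is 4 or 8 times an
    odd [q] not divisible by 9, and [q] is coprime to 6 or three times such a number. In [nc_prod]
    only the second factor may be a mere near cube, so order 3 is available once; hence the factors
    9. *)
Lemma nc_exists (n : nat) : (0 < n)%N -> (4 %| n)%N -> has_nc n.
Proof.
elim/ltn_ind: n => n IH n0 n4.
have [/dvdnP[k e]|n16] := boolP (16 %| n)%N.
  have k0 : (0 < k)%N by move: n0; rewrite e; case: (k).
  rewrite e (_ : k * 16 = 4 * (k * 4))%N; last by rewrite (mulnC 4%N) -mulnA.
  apply: nc_prod has_mds4 _; apply: IH; rewrite ?muln_gt0 ?k0 ?dvdn_mull //.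
  by rewrite e ltn_pmul2l.
have [/dvdnP[k e]|n9] := boolP (9 %| n)%N.
  have k0 : (0 < k)%N by move: n0; rewrite e; case: (k).
  rewrite e mulnC; apply: nc_prod has_mds9 _; apply: IH => //.
    by rewrite e -{1}(muln1 k) ltn_pmul2l.
  by rewrite e Gauss_dvdl in n4.
have odd_nc q : odd q -> ~~ (9 %| q)%N -> has_nc q.
  move=> oq n9q; have c2 : coprime q 2 by rewrite coprimen2.
  have [/dvdnP[k e]|n3] := boolP (3 %| q)%N.
    rewrite e; apply: nc_prod has_nc3; apply: mds_coprime6.
    rewrite (_ : 6 = 2 * 3)%N // coprimeMr; apply/andP; split.
      by rewrite coprimen2; move: oq; rewrite e oddM => /andP[].
    rewrite coprime_sym prime_coprime //; apply: contra n9q => /dvdnP[h ek].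
    by rewrite e ek -mulnA dvdn_mull.
  apply/mds_has_nc/mds_coprime6; rewrite (_ : 6 = 2 * 3)%N // coprimeMr c2.
  by rewrite coprime_sym prime_coprime.
case/dvdnP: n4 => k e; have [admissible|ek] := boolP (odd k).
  rewrite e mulnC; apply: nc_prod has_mds4 _; apply: odd_nc => //.
  by apply: contra n9 => d; rewrite e dvdn_mulr.
have e' : n = (8 * k./2)%N.
  by rewrite e -{1}(odd_double_half k) (negbTE ek) add0n -muln2 -mulnA mulnC.
rewrite e'; apply: nc_prod has_mds8 _; apply: odd_nc.
  apply: contraR n16 => nk; rewrite e' -(odd_double_half k./2) (negbTE nk) add0n -muln2.
  by rewrite (mulnC _ 2%N) mulnA dvdn_mulr.
by apply: contra n9 => d; rewrite e' dvdn_mull.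
Qed.

Local Close Scope ring_scope.

(** * Packings of triples *)

(** The packing half of exact coverage; [cvd] below gives the covering half. Families of blocks are
    kept apart by comparing the triples they cover. *)
Definition uniq3 (T : finType) (B : {set {set T}}) : Prop :=
  forall (t : {set T}) b b', #|t| = 3 -> b \in B -> b' \in B -> t \subset b -> t \subset b' -> b = b'.

Definition cvd (T : finType) (B : {set {set T}}) (t : {set T}) : Prop :=
  exists2 b, b \in B & t \subset b.

Lemma once_uniq3 (T : finType) (B : {set {set T}}) (t : {set T}) (b b' : {set T}) :
  #|[set b in B | t \subset b]| = 1 -> b \in B -> b' \in B -> t \subset b -> t \subset b' -> b = b'.
Proof.
move/eqP/cards1P=> [c e] bB b'B tb tb'.
have : b \in [set c] by rewrite -e inE bB.
have : b' \in [set c] by rewrite -e inE b'B.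
by rewrite !inE => /eqP-> /eqP.
Qed.

Lemma once_cvd (T : finType) (B : {set {set T}}) (t : {set T}) :
  #|[set b in B | t \subset b]| = 1 -> cvd B t.
Proof.
move/eqP/cards1P=> [c e]; have := set11 c; rewrite -e inE => /andP[]; by exists c.
Qed.

Lemma three_wise_onceI (T : finType) (B : {set {set T}}) :
  uniq3 B -> (forall t : {set T}, #|t| = 3 -> cvd B t) -> three_wise_once B.
Proof.
move=> u c t t3; apply/eqP/cards1P; have [b bB tb] := c t t3.
exists b; apply/setP=> b'; rewrite !inE; apply/andP/eqP => [[b'B tb']|->//].
exact: (u t).
Qed.

Lemma uniq3U (T : finType) (B B' : {set {set T}}) : uniq3 B -> uniq3 B' ->
  (forall t : {set T}, #|t| = 3 -> cvd B t -> cvd B' t -> False) -> uniq3 (B :|: B').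
Proof.
move=> u u' d t b b' t3; rewrite !inE => /orP[] bB /orP[] b'B tb tb'.
- exact: (u t).
- by case: (d t t3); [exists b | exists b'].
- by case: (d t t3); [exists b' | exists b].
- exact: (u' t).
Qed.

Lemma uniq3_bigcup (T I : finType) (B : I -> {set {set T}}) : (forall i, uniq3 (B i)) ->
  (forall i j (t : {set T}), #|t| = 3 -> cvd (B i) t -> cvd (B j) t -> i = j) ->
  uniq3 (\bigcup_i B i).
Proof.
move=> u d t b b' t3 /bigcupP[i _ bi] /bigcupP[j _ bj] tb tb'.
have ij : i = j by apply: (d i j t) => //; [exists b | exists b'].
by rewrite -ij in bj; exact: (u i t).
Qed.

Lemma cvdU (T : finType) (B B' : {set {set T}}) t : cvd B t \/ cvd B' t -> cvd (B :|: B') t.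
Proof. by case=> -[b bB tb]; exists b => //; rewrite inE bB ?orbT. Qed.

Lemma cvd_bigcup (T I : finType) (B : I -> {set {set T}}) i t :
  cvd (B i) t -> cvd (\bigcup_i B i) t.
Proof. by case=> b bB tb; exists b => //; apply/bigcupP; exists i. Qed.

Lemma cvd_bigcupE (T I : finType) (B : I -> {set {set T}}) t :
  cvd (\bigcup_i B i) t -> exists i, cvd (B i) t.
Proof. by case=> b /bigcupP[i _ bB] tb; exists i, b. Qed.

Definition push (T T' : finType) (f : T -> T') (B : {set {set T}}) : {set {set T'}} :=
  [set f @: (b : {set T}) | b in B].

Lemma push_range (T T' : finType) (f : T -> T') (B : {set {set T}}) t :
  cvd (push f B) t -> exists2 t0, cvd B t0 & t = f @: t0.
Proof.
case=> _ /imsetP[b bB ->] tb; exists (b :&: f @^-1: t).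
  by exists b => //; exact: subsetIl.
apply/setP=> x; apply/idP/imsetP => [xt|[y]]; last by rewrite !inE => /andP[_ yt] ->.
by have /imsetP[y yb e] := subsetP tb x xt; exists y => //; rewrite !inE yb -e.
Qed.

Lemma push_cvd (T T' : finType) (f : T -> T') (B : {set {set T}}) t :
  cvd B t -> cvd (push f B) (f @: t).
Proof. by case=> b bB tb; exists (f @: b); [exact: imset_f | exact: imsetS]. Qed.

Lemma push_uniq3 (T T' : finType) (f : T -> T') (B : {set {set T}}) :
  injective f -> uniq3 B -> uniq3 (push f B).
Proof.
move=> fI u t _ _ t3 /imsetP[b bB ->] /imsetP[b' b'B ->] tb tb'; suff -> : b = b' by [].
have e : f @: (f @^-1: t) = t.
  apply/setP=> x; apply/imsetP/idP => [[y]|xt]; first by rewrite inE => ? ->.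
  by have /imsetP[y yb e] := subsetP tb x xt; exists y => //; rewrite inE -e.
apply: (u (f @^-1: t)) => //; first by rewrite -(card_imset _ fI) e.
  by apply/subsetP=> x; rewrite inE => /(subsetP tb); rewrite mem_imset.
by apply/subsetP=> x; rewrite inE => /(subsetP tb'); rewrite mem_imset.
Qed.

(** * Transversal blocks read off from words *)

Definition blk (I W T : finType) (p : I -> W -> T) (w : {ffun I -> W}) : {set T} :=
  [set p i (w i) | i : I].

Definition code_fam (I W T : finType) (p : I -> W -> T) (C : {set {ffun I -> W}}) :=
  [set blk p w | w in C].

Definition inj2 (I W T : finType) (p : I -> W -> T) : Prop :=
  forall i j a b, p i a = p j b -> i = j /\ a = b.

Lemma blk_inj (I W T : finType) (p : I -> W -> T) w : inj2 p -> injective (fun i => p i (w i)).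
Proof. by move=> pI i j /pI[]. Qed.

Lemma mem_blk (I W T : finType) (p : I -> W -> T) i a w : inj2 p ->
  (p i a \in blk p w) = (a == w i).
Proof.
move=> pI; apply/imsetP/eqP => [[j _ /pI[-> ->]]//|->]; by exists i.
Qed.

Lemma card_blk (I W T : finType) (p : I -> W -> T) w : inj2 p -> #|blk p w| = #|I|.
Proof. by move=> pI; rewrite card_imset //; exact: blk_inj. Qed.

(** A triple in a four-point block omits one point, so it amounts to a word with its entry at [i]
    erased. *)
Lemma code_trace (I W T : finType) (p : I -> W -> T) (w : {ffun I -> W}) (t : {set T}) :
  inj2 p -> #|I| = 4 -> #|t| = 3 -> t \subset blk p w ->
  exists i, forall j, (p j (w j) \in t) = (j != i).
Proof.
move=> pI I4 t3 tw; pose J := [set j | p j (w j) \in t].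
have e : t = [set p j (w j) | j in J].
  apply/setP=> x; apply/idP/imsetP => [xt|[j]]; last by rewrite inE => ? ->.
  by have /imsetP[j _ xj] := subsetP tw x xt; exists j => //; rewrite inE -xj.
have J3 : #|J| = 3 by rewrite -t3 e card_imset //; exact: blk_inj.
have /cards1P[i iJ] : #|~: J| == 1 by rewrite -(eqn_add2l #|J|) cardsC J3 I4.
by exists i => j; rewrite -(in_set1 j i) -iJ !inE negbK.
Qed.

(** Blocks sharing a triple come from words that differ in at most one coordinate, so minimum
    distance 2 gives a packing. *)
Lemma code_uniq3 (I W T : finType) (p : I -> W -> T) (C : {set {ffun I -> W}}) :
  inj2 p -> #|I| = 4 ->
  (forall i x y, x \in C -> y \in C -> eqoff i x y -> x = y) -> uniq3 (code_fam p C).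
Proof.
move=> pI I4 d t _ _ t3 /imsetP[w wC ->] /imsetP[w' w'C ->] tw tw'; suff -> : w = w' by [].
have [i iP] := code_trace pI I4 t3 tw; apply: (d i) => // j.
by rewrite -iP => /(subsetP tw'); rewrite mem_blk // => /eqP.
Qed.

(** [v] is any word spelling out [t] away from [i]; a code word agreeing with it there gives a block
    through [t]. *)
Lemma code_cvd (I W T : finType) (p : I -> W -> T) (C : {set {ffun I -> W}}) i v w (t : {set T}) :
  t \subset blk p v -> p i (v i) \notin t -> w \in C -> eqoff i v w -> cvd (code_fam p C) t.
Proof.
move=> tv it wC e; exists (blk p w); first exact: imset_f.
apply/subsetP=> x xt; have /imsetP[j _ xj] := subsetP tv x xt.
have nji : j != i by apply: contraNneq it => <-; rewrite -xj.
by rewrite xj e //; apply/imsetP; exists j.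
Qed.

(** * Doubling a 3-BBD *)

Definition meets_both (T : finType) (s : pred T) (t : {set T}) : Prop :=
  (exists2 x, x \in t & s x) /\ (exists2 y, y \in t & ~~ s y).

(** The equivalence also says that no triple inside one side is covered, which later separates the
    link blocks from the filled groups. *)
Definition bbd (T : finType) (s : pred T) (B : {set {set T}}) : Prop :=
  [/\ forall b, b \in B -> #|b| = 4, uniq3 B &
      forall t : {set T}, #|t| = 3 -> cvd B t <-> meets_both s t].

Lemma set3_cover (T : finType) (t : {set T}) x y z : #|t| = 3 ->
  x \in t -> y \in t -> z \in t -> x != y -> x != z -> y != z ->
  forall u, u \in t -> [\/ u = x, u = y | u = z].
Proof.
move=> t3 xt yt zt xy xz yz u ut.
have e : [set x; y; z] = t.
  apply/eqP; rewrite eqEcard t3; apply/andP; split.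
    by apply/subsetP=> v; rewrite !inE => /orP[/orP[]|]/eqP->.
  by rewrite -setUA cardsU1 cards2 !inE negb_or xy xz yz.
by move: ut; rewrite -e !inE => /orP[/orP[]|]/eqP->; [constructor 1|constructor 2|constructor 3].
Qed.

Lemma bbd_of_3BBD (n : nat) (g1 : {set 'I_n}) (B : {set {set 'I_n}}) :
  is_3BBD g1 B -> bbd (mem g1) B.
Proof.
case=> _ [B4 B3].
have mb b (t : {set 'I_n}) : b \in B -> t \subset b -> #|t| = 3 -> meets_both (mem g1) t.
  move=> /B4[b4 [bg1 bg2]] tb t3.
  have h (g : {set 'I_n}) : #|b :&: g| = 2 -> exists2 x, x \in t & x \notin g.
    move=> bg; apply/subsetPn; apply/negP=> tg.
    have: t \subset b :&: g by rewrite subsetI tb.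
    by move/subset_leq_card; rewrite t3 bg.
  have [x xt xg] := h _ bg2; have [y yt yg] := h _ bg1.
  by split; [exists x => //; move: xg; rewrite inE negbK | exists y].
have one (t : {set 'I_n}) : #|t| = 3 -> meets_both (mem g1) t -> #|[set b in B | t \subset b]| = 1.
  move=> t3 [[x xt xg] [y yt yg]]; apply: B3 => //; apply/set0Pn.
    by exists x; rewrite inE xt.
  by exists y; rewrite !inE yt.
split=> [b /B4[]//|t b b' t3 bB b'B tb tb'|t t3].
  exact: (once_uniq3 (one t t3 (mb _ _ bB tb t3))).
split=> [[b bB tb]|/(one t t3)]; [exact: mb tb t3|exact: once_cvd].
Qed.

(** Fix two points [a], [b] of [g1]. Each point of the other part lies with them in exactly one
    block, and each block through them has two such points. The blocks thus pair up the other part,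
    whose size [n / 2] is therefore even. *)
Lemma dvd4_3BBD (n : nat) (g1 : {set 'I_n}) (B : {set {set 'I_n}}) :
  2 < n -> is_3BBD g1 B -> 4 %| n.
Proof.
move=> n2 [g12 [B4 B3]].
have nE : n = #|~: g1| + #|~: g1| by rewrite -{2}g12 addnC cardsC card_ord.
have : 1 < #|g1| by rewrite g12; move: n2; rewrite {1}nE; case: #|~: g1| => [|[]].
case/card_gt1P=> a [b [ag bg nab]].
pose F := [set c in B | (a \in c) && (b \in c)].
suff e : #|~: g1| = #|F| * 2 by rewrite nE e -mulnDr dvdn_mull.
rewrite -sum_nat_const (eq_bigr (fun c : {set 'I_n} => \sum_(x in ~: g1) (x \in c : nat)));
  last first.
  move=> c; rewrite inE => /andP[/B4[_ [_ <-]] _].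
  rewrite -sum1_card big_mkcond [RHS]big_mkcond; apply: eq_bigr => x _.
  by rewrite in_setI andbC; case: (x \in ~: g1) => //=; case: (x \in c).
rewrite exchange_big /= -sum1_card; apply: eq_bigr => x xg.
have xNg : x \notin g1 by move: xg; rewrite inE.
have t3 : #|[set a; b; x]| = 3.
  rewrite -setUA cardsU1 cards2 !inE negb_or nab.
  by rewrite !(contraNneq _ xNg) // => <-.
have : #|[set c in B | [set a; b; x] \subset c]| = 1.
  apply: B3 => //; apply/set0Pn; first by exists a; rewrite !inE eqxx.
  by exists x; rewrite !inE eqxx orbT.
rewrite -sum1_card => {1}<-; rewrite big_mkcond [RHS]big_mkcond.
apply: eq_bigr => c _; rewrite !inE !subUset !sub1set.
by case: (c \in B); case: (a \in c); case: (b \in c); case: (x \in c).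
Qed.

Lemma bbd_push (T T' : finType) (f : T -> T') (s : pred T) (s' : pred T') B :
  bijective f -> (forall x, s' (f x) = s x) -> bbd s B -> bbd s' (push f B).
Proof.
move=> [g fK gK] sf [B4 Bu Bc]; have fI := can_inj fK.
split=> [_ /imsetP[b bB ->]||t t3]; first by rewrite card_imset // B4.
  exact: push_uniq3.
have e : t = f @: (g @: t) by rewrite -imset_comp (eq_imset _ gK) imset_id.
have [t0 t0E] : exists t0 : {set T}, t = f @: t0 by exists (g @: t).
have c3 : #|t0| = 3 by rewrite -t3 t0E card_imset.
have mE : meets_both s' t <-> meets_both s t0.
  rewrite t0E; split=> -[].
    by move=> [_ /imsetP[x xt ->] sx] [_ /imsetP[y yt ->] sy]; split; [exists x|exists y];
      rewrite -?sf.
  by move=> [x xt sx] [y yt sy]; split; [exists (f x)|exists (f y)]; rewrite ?imset_f ?sf.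
split=> [|/mE/(Bc _ c3)/(push_cvd f)]; last by rewrite -t0E.
case/push_range=> t1 t1c; rewrite {1}t0E => /(imset_inj fI) e1.
by apply/mE/(Bc _ c3); rewrite e1.
Qed.

Local Open Scope ring_scope.

(** Points of the doubled design are triples of side, copy and element; a choice of one copy on each
    side gives one copy of the original design. *)
Definition dbl (W : Type) (a b : 'I_2) (x : 'I_2 * W) : 'I_2 * ('I_2 * W) :=
  (x.1, (if x.1 == 0 then a else b, x.2)).

Definition quarter (W : Type) (i : 'I_2 * 'I_2) (a : W) : 'I_2 * ('I_2 * W) := (i.1, (i.2, a)).

Lemma ord2_neq (i j k : 'I_2) : i != j -> k != j -> i = k.
Proof.
by case: i j k => [[|[|//]] ?] [[|[|//]] ?] [[|[|//]] ?] // _ _; apply: val_inj.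
Qed.

(** A mixed triple has two points on one side. If these lie in the same copy, the triple belongs to
    exactly one of the four copies of [B]. Otherwise it occupies three of the four quarters and is
    completed by a zero-sum word. *)
Lemma bbd_double (W : finZmodType) (B : {set {set 'I_2 * W}}) :
  bbd (fun x => x.1 == 0) B ->
  bbd (fun x => x.1 == 0)
    (\bigcup_(ab : 'I_2 * 'I_2) push (dbl ab.1 ab.2) B :|:
     code_fam (@quarter W) (zero_sum _ W)).
Proof.
case=> B4 Bu Bc.
have fI a b : injective (@dbl W a b).
  by move=> [i x] [j y] [] -> _ ->.
have qI : inj2 (@quarter W).
  by move=> [i i'] [j j'] x y [-> -> ->].
have I4 : #|{: 'I_2 * 'I_2}| = 4 by rewrite card_prod !card_ord.
have [Ze Zu] := zero_sum_cube ('I_2 * 'I_2)%type W.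
have trace a b (t : {set 'I_2 * ('I_2 * W)}) : #|t| = 3 -> cvd (push (dbl a b) B) t ->
    [/\ exists2 x, x \in t & x.1 == 0, exists2 x, x \in t & x.1 != 0 &
        forall x, x \in t -> x.2.1 = if x.1 == 0 then a else b].
  move=> t3 /push_range[t0 c te]; have t03 : #|t0| = 3 by rewrite -t3 te card_imset.
  move/(Bc t0 t03): c => [[x xt x0] [y yt y0]]; rewrite te; split.
  - by exists (dbl a b x); rewrite ?imset_f.
  - by exists (dbl a b y); rewrite ?imset_f.
  - by move=> _ /imsetP[z _ ->].
have ctrace (t : {set 'I_2 * ('I_2 * W)}) :
  #|t| = 3 -> cvd (code_fam (@quarter W) (zero_sum _ W)) t ->
    exists e : 'I_2, (forall h, exists a, (e, (h, a)) \in t) /\ exists2 x, x \in t & x.1 != e.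
  move=> t3 [_ /imsetP[w _ ->] tw]; have [[e h] iP] := code_trace qI I4 t3 tw.
  have [e' ne] : exists e' : 'I_2, e' != e by exists (e + 1); case: (e) => [[|[|//]] ?].
  exists e'; split=> [h'|].
    by exists (w (e', h')); have := iP (e', h'); rewrite xpair_eqE (negbTE ne).
  have [h' nh] : exists h' : 'I_2, h' != h by exists (h + 1); case: (h) => [[|[|//]] ?].
  exists (quarter (e, h') (w (e, h'))); last by rewrite eq_sym.
  by rewrite iP xpair_eqE eqxx.
split.
- move=> b; rewrite inE => /orP[/bigcupP[ab _ /imsetP[b0 b0B ->]]|/imsetP[w _ ->]].
    by rewrite card_imset // B4.
  by rewrite card_blk.
- apply: uniq3U; last 1 first.
  + move=> t t3 /cvd_bigcupE[[a b] /(trace a b t t3)[_ _ ab]] /(ctrace t t3)[e [eh _]].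
    have [x0 /ab /= e0] := eh 0; have [x1 /ab /= e1] := eh 1.
    by move: e0; rewrite -e1.
  + apply: uniq3_bigcup => [[a b]|[a b] [a' b'] t t3 c c']; first exact: push_uniq3.
    have [[x xt x0] [y yt y0] ab] := trace a b t t3 c.
    have [_ _ ab'] := trace a' b' t t3 c'.
    have := ab x xt; rewrite (ab' x xt) x0 => ->.
    by have := ab y yt; rewrite (ab' y yt) (negbTE y0) => ->.
  + exact: code_uniq3.
move=> t t3; split.
  case=> b; rewrite inE => /orP[bB|bC] tb.
    have [[a c] tc] : exists i : 'I_2 * 'I_2, cvd (push (dbl i.1 i.2) B) t.
      by apply: cvd_bigcupE; exists b.
    by have [? ? _] := trace _ _ _ t3 tc.
  have [|e [eh [x xt xe]]] := ctrace t t3; first by exists b.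
  have [a at'] := eh 0.
  have [e0|e0] := eqVneq e 0.
    by rewrite e0 in at' xe; split; [exists (0, (0, a)) | exists x].
  by split; [exists x | exists (e, (0, a))] => //; rewrite (ord2_neq xe (k := 0)) // eq_sym.
case=> [[x xt /eqP x0] [y yt y0]].
pose good (z : 'I_2 * ('I_2 * W)) := z.2.1 == if z.1 == 0 then x.2.1 else y.2.1.
have [/forall_inP tg|] := boolP [forall z in t, good z].
  apply: cvdU; left; apply: (@cvd_bigcup _ _ _ (x.2.1, y.2.1)) => /=.
  pose t0 := [set (z.1, z.2.2) | z in t].
  have te : t = dbl x.2.1 y.2.1 @: t0.
    rewrite -imset_comp -[LHS]imset_id; apply: eq_in_imset => -[i [j z]] /tg/eqP /= {1}->.
    by [].
  have t0P z : z \in t -> (z.1, z.2.2) \in t0 by exact: imset_f.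
  clearbody t0; rewrite te; apply: push_cvd; apply/Bc; first by rewrite -t3 te card_imset.
  split; [exists (x.1, x.2.2) | exists (y.1, y.2.2)]; rewrite ?t0P //=.
  by rewrite x0.
move=> /forall_inPn[z zt /negP zg]; apply: cvdU; right.
(* [x'] shares the side of the offending point [z] but not its copy, while [y'] is on the other
   side. *)
have [x' [y' [x't y't zx nzx zy]]] :
  exists x' y', [/\ x' \in t, y' \in t, z.1 = x'.1, z.2.1 != x'.2.1 & z.1 != y'.1].
  rewrite /good in zg; have [z0|z0] := eqVneq z.1 0.
    exists x, y; split=> //; rewrite ?z0 ?x0 1?eq_sym //.
    by apply/eqP=> h; apply: zg; rewrite z0 eqxx h.
  exists y, x; split=> //; rewrite ?x0 //; first exact: ord2_neq z0 y0.
  by apply/eqP=> h; apply: zg; rewrite (negbTE z0) h.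
have cover := set3_cover t3 zt x't y't.
have [h nh] : exists h : 'I_2, h != y'.2.1 by exists (y'.2.1 + 1); case: (y'.2.1) => [[|[|//]] ?].
(* The word through [z], [x'] and [y']; its entry at the missed quarter [(y'.1, h)] is a filler,
   replaced in [w]. *)
pose v : {ffun 'I_2 * 'I_2 -> W} :=
  [ffun i => if i.1 == z.1 then (if i.2 == z.2.1 then z.2.2 else x'.2.2) else y'.2.2].
have [w wZ e] := Ze (y'.1, h) v.
have vE u : u \in t -> u = quarter (u.1, u.2.1) (v (u.1, u.2.1)).
  move=> ut; have [] := cover _ _ _ u ut.
  - by apply: contraNneq nzx => ->.
  - by apply: contraNneq zy => ->.
  - by apply: contraNneq zy => <-; rewrite zx.
  - by move=> ->; rewrite /quarter ffunE /= !eqxx; case: (z) => [? [? ?]].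
  - by move=> ->; rewrite /quarter ffunE /= zx eqxx eq_sym (negbTE nzx); case: (x') => [? [? ?]].
  - by move=> ->; rewrite /quarter ffunE /= eq_sym (negbTE zy); case: (y') => [? [? ?]].
apply: (@code_cvd _ _ _ _ _ (y'.1, h) v w) => //.
  by apply/subsetP=> u /vE ->; apply/imsetP; exists (u.1, u.2.1).
apply/negP=> ut; have [] := cover _ _ _ _ ut.
- by apply: contraNneq nzx => ->.
- by apply: contraNneq zy => ->.
- by apply: contraNneq zy => <-; rewrite zx.
- by move=> ez; move: zy; rewrite -ez eqxx.
- by move=> ez; move: zy; rewrite zx -ez eqxx.
- by move=> ez; move: nh; rewrite -ez eqxx.
Qed.

Local Close Scope ring_scope.

(** * Inflating the system of order 10 *)

Definition cls10 := (bool + 'I_4 * bool)%type.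

Definition code10 (z : cls10) : nat :=
  match z with inl b => b | inr (i, e) => 2 + i + 4 * e end.

Definition decode10 (k : nat) : cls10 :=
  if k < 2 then inl (k == 1) else inr (Ordinal (ltn_pmod (k - 2) (isT : 0 < 4)), 5 < k).

Lemma code10K : cancel code10 decode10.
Proof.
by case=> [[]|[[[|[|[|[|//]]]] ?] []]] //; rewrite /decode10 /=; congr (inr (_, _)); apply: val_inj.
Qed.

Lemma decode10K k : k < 10 -> code10 (decode10 k) = k.
Proof. by do 10 case: k => [//|k]. Qed.

Lemma code10_lt z : code10 z < 10.
Proof. by case: z => [[]|[[[|[|[|[|//]]]] ?] []]]. Qed.

(* The blocks of the inversive plane of order 3 (points: [F_9] and infinity) that do not contain
   both 0 and infinity. Here 0 and 1 encode 0 and infinity, and [2 + e] encodes [w ^ e] for a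
   generator [w] of the multiplicative group; the groups are the pairs [{a, -a}]. *)
Definition blocks10 : seq (seq nat) :=
  [:: [:: 0; 2; 3; 8]; [:: 0; 2; 4; 5]; [:: 0; 2; 7; 9]; [:: 0; 3; 4; 9]; [:: 0; 3; 5; 6];
      [:: 0; 4; 6; 7]; [:: 0; 5; 7; 8]; [:: 0; 6; 8; 9]; [:: 1; 2; 3; 5]; [:: 1; 2; 4; 9];
      [:: 1; 2; 7; 8]; [:: 1; 3; 4; 6]; [:: 1; 3; 8; 9]; [:: 1; 4; 5; 7]; [:: 1; 5; 6; 8];
      [:: 1; 6; 7; 9]; [:: 2; 3; 4; 7]; [:: 2; 3; 6; 9]; [:: 2; 4; 6; 8]; [:: 2; 5; 6; 7];
      [:: 2; 5; 8; 9]; [:: 3; 4; 5; 8]; [:: 3; 5; 7; 9]; [:: 3; 6; 7; 8]; [:: 4; 5; 6; 9];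
      [:: 4; 7; 8; 9]].

(** Its failure means lying in group [i] extended by the two points at infinity, the part to be
    filled with a given system. *)
Definition off_grp (i : 'I_4) (z : cls10) : bool :=
  if z is inr (j, _) then j != i else false.

Definition touches (t : {set cls10}) (i : 'I_4) : bool := [exists e, inr (i, e) \in t].

Definition cand10 : {set {set cls10}} :=
  [set b in [seq [set z | code10 z \in l] | l <- blocks10]].

Lemma cand10P b : reflect (exists2 l, l \in blocks10 & b = [set z | code10 z \in l]) (b \in cand10).
Proof. by rewrite inE; apply: (iffP mapP). Qed.

Lemma cand10_card b : b \in cand10 -> #|b| = 4.
Proof.
case/cand10P=> l lB ->; have: all (fun l =>
  [&& uniq l, size l == 4 & all (ltn^~ 10) l]) blocks10 by [].
move/allP/(_ l lB)/and3P=> [ul /eqP l4 /allP l10].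
have e k : k \in l -> code10 (decode10 k) = k by move/l10/decode10K.
have ml : map code10 (map decode10 l) = l by rewrite -map_comp; apply: map_id_in => k /e.
have/card_uniqP : uniq (map decode10 l) by apply: (@map_uniq _ _ code10); rewrite ml.
rewrite size_map l4; apply: etrans; apply: eq_card => z; rewrite inE.
by rewrite -[in RHS](mem_map (can_inj code10K)) ml.
Qed.

(** This property of the list makes inflation possible: a block meeting at most three groups
    constrains its word on at most one face. *)
Lemma cand10_miss b : b \in cand10 -> exists i, ~~ touches b i.
Proof.
case/cand10P=> l lB ->.
have: all (fun l => has (fun i => (2 + i \notin l) && (6 + i \notin l)) (iota 0 4)) blocks10 by [].
move/allP/(_ l lB)/hasP=> [i]; rewrite mem_iota /= => i4 /andP[n2 n6].
exists (Ordinal i4); apply/negP=> /existsP[e]; rewrite inE /=.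
by case: e; rewrite ?addn0 ?(negbTE n2) // (addnC _ 4) addnA (negbTE n6).
Qed.

Lemma count_le1 (T : eqType) (p : pred T) (s : seq T) x y :
  count p s <= 1 -> x \in s -> y \in s -> p x -> p y -> x = y.
Proof.
rewrite -size_filter => c xs ys px py.
have: x \in filter p s by rewrite mem_filter px.
have: y \in filter p s by rewrite mem_filter py.
by case: (filter p s) c => [|z [|]] // _; rewrite !inE => /eqP-> /eqP.
Qed.

(** Numerical form of not lying in one group extended by infinity. The group of the code [k] is
    [(k - 2) %% 4]; the guard [1 < k] excludes infinity, where the subtraction would truncate. *)
Definition spread (a b c : nat) : bool :=
  all (fun i => has (fun k => (1 < k) && ((k - 2) %% 4 != i)) [:: a; b; c]) (iota 0 4).

(** Exhaustive check that spread triples are covered once and other triples never; the boolean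
    [spread] is read as 1 or 0. *)
Lemma blocks10_check : all (fun a => all (fun b => all (fun c =>
  [&& a != b, b != c & c != a] ==>
  (count (fun l => [&& a \in l, b \in l & c \in l]) blocks10 == spread a b c))
  (iota 0 10)) (iota 0 10)) (iota 0 10).
Proof. by vm_compute. Qed.

Lemma blocks10_count (x y z : cls10) : x != y -> y != z -> z != x ->
  count (fun l => [&& code10 x \in l, code10 y \in l & code10 z \in l]) blocks10 =
  spread (code10 x) (code10 y) (code10 z).
Proof.
move=> xy yz zx; have m u : code10 u \in iota 0 10 by rewrite mem_iota code10_lt.
have /allP/(_ _ (m x))/allP/(_ _ (m y))/allP/(_ _ (m z)) := blocks10_check.
by rewrite !(inj_eq (can_inj code10K)) xy yz zx => /eqP.
Qed.

Lemma cand10_uniq3 : uniq3 cand10.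
Proof.
move=> t _ _ t3 /cand10P[l lB ->] /cand10P[l' l'B ->] tl tl'; suff -> : l = l' by [].
have /card_gt2P[x [y [z [[xt yt zt] [xy yz zx]]]]] : 2 < #|t| by rewrite t3.
have [lP l'P] : {in t, forall u, code10 u \in l} /\ {in t, forall u, code10 u \in l'}.
  by split=> u => [/(subsetP tl)|/(subsetP tl')]; rewrite inE.
apply: (@count_le1 _ (fun l : seq nat =>
  [&& code10 x \in l, code10 y \in l & code10 z \in l]) _ _ _ _ lB l'B); first by rewrite (blocks10_count xy yz zx); case: spread.
  by rewrite !lP.
by rewrite !l'P.
Qed.

Lemma cand10_cvd (t : {set cls10}) : #|t| = 3 ->
  (cvd cand10 t <-> forall i, exists2 z, z \in t & off_grp i z).
Proof.
move=> t3.
have /card_gt2P[x [y [z [[xt yt zt] [xy yz zx]]]]] : 2 < #|t| by rewrite t3.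
have cov := set3_cover t3 xt yt zt xy; rewrite eq_sym in zx; have {}cov := cov zx yz.
have offE i u : off_grp i u = (1 < code10 u) && ((code10 u - 2) %% 4 != i).
  by case: u => [[]|[[j ?] []]] //=;
    rewrite ?addn0 -?addnA (addKn 2) ?modnDr ?muln1 ?modnDr modn_small.
have sp : reflect (forall i, exists2 u, u \in t & off_grp i u) (spread (code10 x) (code10 y) (code10 z)).
  apply: (iffP allP) => [h i|h i].
    have := h i; rewrite mem_iota ltn_ord => /(_ isT) /hasP[k].
    by rewrite !inE => /or3P[]/eqP->; rewrite -offE; [exists x|exists y|exists z].
  rewrite mem_iota => /andP[_ i4]; have [u ut] := h (Ordinal i4); rewrite offE => uo.
  by apply/hasP; exists (code10 u) => //; case: (cov u ut) => ->; rewrite !inE eqxx ?orbT.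
rewrite eq_sym in zx; have H := blocks10_count xy yz zx.
have hE : has (fun l => [&& code10 x \in l, code10 y \in l & code10 z \in l]) blocks10 =
    spread (code10 x) (code10 y) (code10 z) by rewrite has_count H; case: spread.
split=> [[b /cand10P[l lB ->] tl]|/sp]; last rewrite -hE.
  have lP u : u \in t -> code10 u \in l by move/(subsetP tl); rewrite inE.
  by apply/sp; rewrite -hE; apply/hasP; exists l => //; rewrite !lP.
case/hasP=> l lB /and3P[xl yl zl]; exists [set u | code10 u \in l]; first by apply/cand10P;
  exists l.
by apply/subsetP=> u /cov[] ->; rewrite inE.
Qed.

(** * Inflation along words *)

Notation pt K := (bool + 'I_4 * bool * K)%type.

Definition cls (K : Type) (z : pt K) : cls10 :=
  match z with inl b => inl b | inr (c, _) => inr c end.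

(** A word selects a copy of the ten-point system in which both classes of a group carry the same
    element of [K]. *)
Definition phi (K : finType) (x : {ffun 'I_4 -> K}) (z : cls10) : pt K :=
  match z with inl b => inl b | inr (i, e) => inr (i, e, x i) end.

Lemma phiK (K : finType) (x : {ffun 'I_4 -> K}) : cancel (phi x) (@cls K).
Proof. by case=> [b|[i e]]. Qed.

(** There is no constraint when [b] touches at most two groups; when it touches exactly the groups
    other than [i], the word must be a hole of face [i]. *)
Definition admissible (K : finType) (D : 'I_4 -> {set {ffun 'I_4 -> K}}) x (b : {set cls10}) :
  bool :=
  [forall i, [forall j, (j != i) ==> touches b j] ==> (x \in D i)].

Lemma admissibleP (K : finType) (D : 'I_4 -> {set {ffun 'I_4 -> K}}) x (b : {set cls10}) :
  reflect (forall i, (forall j, j != i -> touches b j) -> x \in D i) (admissible D x b).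
Proof.
apply: (iffP forallP) => h i; first move=> a.
  by move/implyP: (h i); apply; apply/forallP=> j; apply/implyP/a.
by apply/implyP=> /forallP a; apply: h => j; apply/implyP/a.
Qed.

Definition hole_fam (K : finType) (D : 'I_4 -> {set {ffun 'I_4 -> K}}) : {set {set pt K}} :=
  [set phi q.1 @: (q.2 : {set cls10}) | q in [set q | (q.2 \in cand10) && admissible D q.1 q.2]].

Lemma touches_sub (a b : {set cls10}) i : a \subset b -> touches a i -> touches b i.
Proof. by move=> /subsetP ab /existsP[e /ab h]; apply/existsP; exists e. Qed.

Lemma phi_trace (K : finType) (x : {ffun 'I_4 -> K}) (b : {set cls10}) (t : {set pt K}) :
  t \subset phi x @: b ->
  [/\ @cls K @: t \subset b, #|@cls K @: t| = #|t| & forall z, z \in t -> z = phi x (cls z)].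
Proof.
move=> tb; have e z : z \in t -> z = phi x (cls z) /\ cls z \in b.
  by move/(subsetP tb)=> /imsetP[c cb ->]; rewrite phiK.
split; last by move=> z /e[].
  by apply/subsetP=> _ /imsetP[z /e[_ ?] ->].
by apply: card_in_imset => u v /e[-> _] /e[-> _]; rewrite !phiK => ->.
Qed.

Lemma phi_agree (K : finType) (x y : {ffun 'I_4 -> K}) (b : {set cls10}) :
  (forall i, touches b i -> x i = y i) -> phi x @: b = phi y @: b.
Proof.
move=> e; apply: eq_in_imset => -[//|[i h]] ib /=; rewrite e //.
by apply/existsP; exists h.
Qed.

Lemma hole_fam_card (K : finType) (D : 'I_4 -> {set {ffun 'I_4 -> K}}) b :
  b \in hole_fam D -> #|b| = 4.
Proof.
case/imsetP=> -[x c]; rewrite inE => /andP[/cand10_card c4 _] ->.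
by rewrite card_imset //; exact: can_inj (phiK x).
Qed.

Lemma off_touches (b : {set cls10}) i :
  (exists2 z, z \in b & off_grp i z) -> exists2 j, j != i & touches b j.
Proof. by case=> -[//|[j e]] zb /= ji; exists j => //; apply/existsP; exists e. Qed.

(** The classes of a common triple determine [b], and the words agree on the groups that the triple
    touches. If [b] touches a further group [h], it touches all groups but [i0], so both words are
    holes of face [i0], and the Latin square forces agreement at [h]. *)
Lemma hole_fam_uniq3 (K : finType) (Q N : {set {ffun 'I_4 -> K}}) D :
  near_cube Q N D -> uniq3 (hole_fam D).
Proof.
move=> nc t b1 b2 t3 /imsetP[[x b]]; rewrite inE /= => /andP[bC /admissibleP bx] -> /imsetP[[y b']].
rewrite inE /= => /andP[b'C /admissibleP b'y] -> tb tb' {b1 b2}.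
have [sb c3 xE] := phi_trace tb; have [sb' _ yE] := phi_trace tb'; rewrite t3 in c3.
have eb : b = b' by exact: (@cand10_uniq3 _ _ _ c3 bC b'C sb sb').
subst b'.
have ag i : touches (@cls K @: t) i -> x i = y i.
  case/existsP=> e /imsetP[z zt ez]; have := xE z zt; rewrite {1}(yE z zt) -ez.
  by case.
have [i0 ni0] := cand10_miss bC.
apply: phi_agree => h hb; have [/ag//|nh] := boolP (touches (@cls K @: t) h).
have nhi0 : h != i0 by apply: contraNneq ni0 => <-.
have spr : forall i, exists2 z, z \in @cls K @: t & off_grp i z.
  by apply/(cand10_cvd c3); exists b.
have [j _ jt] := off_touches (spr h).
have [l nlj lt] := off_touches (spr j).
have sub i : touches (@cls K @: t) i -> touches b i by exact: touches_sub.
have nj : j != i0 by apply: contraNneq ni0 => <-; exact: sub.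
have nl : l != i0 by apply: contraNneq ni0 => <-; exact: sub.
have u : uniq [:: i0; h; j; l].
  rewrite /= !inE !negb_or !(eq_sym i0) nhi0 nj nl (eq_sym j l) nlj andbT /=.
  by rewrite andbT; apply/andP; split; apply: contraNneq nh => ->.
have rest i : i != i0 -> i != h -> touches (@cls K @: t) i.
  by move=> /negbTE ni /negbTE nih; have := ord4_uniq i u; rewrite !inE ni nih /= => /orP[]/eqP->.
have all i : i != i0 -> touches b i.
  by move=> ni; have [->//|nih] := eqVneq i h; apply/sub/rest.
have xD : x \in D i0 by exact: bx.
have yD : y \in D i0 by exact: b'y.
(* Changing [y] at the missed group keeps it a hole and leaves [h] as the only coordinate where it
   might differ from [x]. *)
have yD' : upd i0 (x i0) y \in D i0 by apply: nc_off yD; [exact: nc | exact: upd_off].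
rewrite (nc_latin_uniq nc nhi0 xD yD') ?ffunE ?(negbTE nhi0) // => k nkh; rewrite ffunE.
by case: eqVneq => [->//|nk]; apply/ag/rest.
Qed.

(** If [x] is not already a hole of the face missed by [b], admissibility leaves a group [h] of that
    face untouched by [c]; the Latin square allows the entry at [h] to be corrected. *)
Lemma hole_fam_cvd (K : finType) (Q N : {set {ffun 'I_4 -> K}}) D x (c : {set cls10}) :
  near_cube Q N D -> #|c| = 3 -> (forall i, exists2 z, z \in c & off_grp i z) ->
  admissible D x c -> cvd (hole_fam D) (phi x @: c).
Proof.
move=> nc c3 /(cand10_cvd c3)[b bC cb] /admissibleP xc; have [i0 ni0] := cand10_miss bC.
suff [y yb xy] : exists2 y, admissible D y b & forall i, touches c i -> x i = y i.
  exists (phi y @: b); last by rewrite (phi_agree xy); exact: imsetS.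
  by apply/imsetP; exists (y, b) => //; rewrite inE bC.
have okb y : y \in D i0 -> admissible D y b.
  move=> yD; apply/admissibleP=> i h; suff -> : i = i0 by [].
  by apply/eqP; apply: contraNT ni0; rewrite eq_sym => /h.
have [xD|nxD] := boolP (x \in D i0); first by exists x; rewrite ?okb.
have [/forall_inP h|] := boolP [forall j in [pred j | j != i0], touches c j].
  by case/negP: nxD; apply: xc.
case/forall_inPn=> h nhi nht; have [y yD e] := nc_latin nc x nhi.
exists y; first exact: okb.
by move=> i it; apply: e; apply: contraNneq nht => <-.
Qed.

(** * The system of order 8n+2 *)

Definition fill (K : Type) (i : 'I_4) (z : bool + bool * K) : pt K :=
  match z with inl b => inl b | inr (e, k) => inr (i, e, k) end.

Definition link (K : Type) (P R : 'I_4 * bool) (z : 'I_2 * K) : pt K :=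
  inr (if z.1 == ord0 then P else R, z.2).

Definition transv (K : Type) (i : 'I_4) (a : bool * K) : pt K := inr (i, a.1, a.2).

(** The sign on the second class is chosen so that the two entries in a group sum to zero exactly
    when both points carry the same element of [K]. *)
Definition square (K : finZmodType) (i j : 'I_4) (u : bool * bool) (a : K) : pt K :=
  inr (if u.1 then j else i, u.2, if u.2 then (- a)%R else a).

(** The parity condition lets the classes in three groups determine the class in the fourth, while
    [N] governs the elements of [K]. *)
Definition even_words (K : finType) (N : {set {ffun 'I_4 -> K}}) : {set {ffun 'I_4 -> bool * K}} :=
  [set w : {ffun 'I_4 -> bool * K} | (\big[addb/false]_i (w i).1 == false) && ([ffun i =>
    (w i).2] \in N)].

(** Since the total is zero, the inequality holds in both groups: in each, the two points carry
    different elements of [K]. *)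
Definition skew_words (K : finZmodType) : {set {ffun bool * bool -> K}} :=
  [set w : {ffun bool * bool -> K} in zero_sum _ K | w (false, false) + w (false, true) != 0]%R.

Definition fill_fam (K : finType) (S : {set {set bool + bool * K}}) : {set {set pt K}} :=
  \bigcup_(i : 'I_4) push (fill i) S.

Definition link_fam (K : finType) (B : {set {set 'I_2 * K}}) : {set {set pt K}} :=
  \bigcup_(q : ('I_4 * bool) * ('I_4 * bool))
     if q.1.1 < q.2.1 then push (link q.1 q.2) B else set0.

Definition square_fam (K : finZmodType) : {set {set pt K}} :=
  \bigcup_(q : 'I_4 * 'I_4) if q.1 < q.2 then code_fam (square q.1 q.2) (skew_words K) else set0.

Definition transv_fam (K : finType) (N : {set {ffun 'I_4 -> K}}) : {set {set pt K}} :=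
  code_fam (@transv K) (even_words N).

Definition spread_set (K : finType) (t : {set pt K}) : Prop :=
  forall i, exists2 z, z \in t & off_grp i (cls z).

Definition cls_inj (K : finType) (t : {set pt K}) : Prop := {in t &, injective (@cls K)}.

Lemma cvd_bigcup_if (T I : finType) (p : pred I) (B : I -> {set {set T}}) t :
  cvd (\bigcup_i if p i then B i else set0) t -> exists2 i, p i & cvd (B i) t.
Proof.
by case/cvd_bigcupE=> i [b]; case: ifP => [pi|]; rewrite ?inE // => bB tb; exists i => //; exists b.
Qed.

Lemma uniq3_bigcup_if (T I : finType) (p : pred I) (B : I -> {set {set T}}) :
  (forall i, p i -> uniq3 (B i)) ->
  (forall i j (t : {set T}), #|t| = 3 -> p i -> p j -> cvd (B i) t -> cvd (B j) t -> i = j) ->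
  uniq3 (\bigcup_i if p i then B i else set0).
Proof.
move=> u d; apply: uniq3_bigcup => [i|i j t t3].
  by case: ifP => [/u//|_] t b b' _; rewrite inE.
case=> b; case: ifP => [pi bB tb|]; rewrite ?inE //.
case=> b'; case: ifP => [pj b'B tb'|]; rewrite ?inE //.
by apply: (d i j t) => //; [exists b | exists b'].
Qed.

Lemma spread_of (K : finType) (t : {set pt K}) c d a b :
  inr (c, a) \in t -> inr (d, b) \in t -> c.1 != d.1 -> spread_set t.
Proof.
case: c d => [c e] [d f] ct dt /= ncd i; have [ic|nci] := eqVneq c i.
  by exists (inr (d, f, b)) => //=; rewrite -ic eq_sym.
by exists (inr (c, e, a)).
Qed.

Lemma fill_trace (K : finType) (S : {set {set bool + bool * K}}) i t :
  cvd (push (fill i) S) t -> forall z, z \in t -> ~~ off_grp i (cls z).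
Proof.
case/push_range=> t0 _ -> _ /imsetP[[b|[e k]] _ ->] //=; by rewrite negbK.
Qed.

Lemma spread_not_filled (K : finType) (S : {set {set bool + bool * K}}) t :
  spread_set t -> ~ cvd (fill_fam S) t.
Proof. by move=> sp /cvd_bigcupE[i /fill_trace h]; have [z /h /negbTE->] := sp i. Qed.

Lemma fill_inj (K : Type) i : injective (@fill K i).
Proof. by move=> [b|[e k]] [b'|[e' k']] //= [] => [->|-> ->]. Qed.

Lemma fill_fam_uniq3 (K : finType) (S : {set {set bool + bool * K}}) :
  uniq3 S -> uniq3 (fill_fam S).
Proof.
move=> uS; apply: uniq3_bigcup => [i|i j t t3 /fill_trace hi /fill_trace hj].
  by apply: push_uniq3 => //; exact: fill_inj.
(* Two extended groups share only the two points at infinity, too few for a triple. *)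
move/eqP: t3 => t3; apply/eqP; apply: contraTT t3 => nij; rewrite neq_ltn ltnS.
have ti : t \subset [set inl true; inl false].
  apply/subsetP=> z zt; have := hi z zt; have := hj z zt.
  case: z {zt} => [[]|[[k e] a]] /=; rewrite ?inE //.
  by rewrite !negbK => /eqP-> /eqP e'; rewrite e' eqxx in nij.
by rewrite (leq_trans (subset_leq_card ti)) // cards2.
Qed.

Lemma fill_cvd (K : finType) (S : {set {set bool + bool * K}}) i (t : {set pt K}) :
  (forall t0 : {set bool + bool * K}, #|t0| = 3 -> cvd S t0) -> #|t| = 3 ->
  (forall z, z \in t -> ~~ off_grp i (cls z)) -> cvd (fill_fam S) t.
Proof.
move=> cS t3 ti; apply: (@cvd_bigcup _ _ _ i).
have e : t = fill i @: (fill i @^-1: t).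
  apply/setP=> z; apply/idP/imsetP => [zt|[y]]; last by rewrite inE => ? ->.
  have := ti z zt; case: z zt => [b|[[k e] a]] zt /=.
    by exists (inl b); rewrite ?inE.
  by rewrite negbK => /eqP ki; exists (inr (e, a)); rewrite ?inE /= -ki.
rewrite e; apply/push_cvd/cS.
by rewrite -(card_imset _ (@fill_inj K i)) -e.
Qed.

Lemma link_inj (K : Type) P R : P.1 != R.1 -> injective (@link K P R).
Proof.
move=> nPR [i a] [j b] [] /= + ->.
case: eqP => [->|ni]; case: eqP => [->|nj] //.
- by move=> e; rewrite e eqxx in nPR.
- by move=> e; rewrite e eqxx in nPR.
by move=> _; congr (_, _); apply: (@ord2_neq _ ord0); apply/eqP.
Qed.

Lemma link_trace (K : finType) (B : {set {set 'I_2 * K}}) P R (t : {set pt K}) :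
  bbd (fun x => x.1 == ord0) B -> #|t| = 3 -> P.1 != R.1 -> cvd (push (link P R) B) t ->
  [/\ exists a, inr (P, a) \in t, exists a, inr (R, a) \in t &
      forall z, z \in t -> exists a, z = inr (P, a) \/ z = inr (R, a)].
Proof.
move=> [_ _ Bc] t3 nPR /push_range[t0 c te].
have t03 : #|t0| = 3 by rewrite -t3 te card_imset //; exact: link_inj.
move/(Bc t0 t03): c => [[[x a] xt /= x0] [[y b] yt /= y0]]; rewrite te; split.
- by exists a; apply/imsetP; exists (x, a); rewrite // /link /= x0.
- by exists b; apply/imsetP; exists (y, b); rewrite // /link /= (negbTE y0).
- move=> _ /imsetP[[z c] _ ->]; rewrite /link /=; exists c.
  by case: ifP; [left | right].
Qed.

Lemma link_fam_spec (K : finType) (B : {set {set 'I_2 * K}}) (t : {set pt K}) :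
  bbd (fun x => x.1 == ord0) B -> #|t| = 3 -> cvd (link_fam B) t ->
  spread_set t /\ ~ cls_inj t.
Proof.
move=> Bb t3 /cvd_bigcup_if[[P R] /= lPR c].
have nPR : P.1 != R.1 by rewrite -val_eqE neq_ltn lPR.
have [[a Pt] [b Rt] h] := link_trace Bb t3 nPR c.
split; first exact: spread_of Pt Rt nPR.
move=> ti; have: #|@cls K @: t| <= #|[set (inr P : cls10); inr R]|.
  apply/subset_leq_card/subsetP=> _ /imsetP[z /h[c' [->|->]] ->]; by rewrite !inE eqxx ?orbT.
by rewrite (card_in_imset ti) t3 cards2; case: (_ != _).
Qed.

(** A covered triple meets both classes, so it recovers the pair; the order on the groups fixes the
    orientation. *)
Lemma link_fam_uniq3 (K : finType) (B : {set {set 'I_2 * K}}) :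
  bbd (fun x => x.1 == ord0) B -> uniq3 (link_fam B).
Proof.
move=> Bb; have ltW (i j : 'I_4) : i < j -> i != j by rewrite -val_eqE neq_ltn => ->.
apply: uniq3_bigcup_if => [[P R] /= /ltW|[P R] [P' R'] t t3 /= l l' c c'].
  by move/(@link_inj K)=> i; case: Bb => _ u _; exact: push_uniq3.
have [[a Pt] [b Rt] h] := link_trace Bb t3 (ltW _ _ l) c.
have [[a' Pt'] [b' Rt'] h'] := link_trace Bb t3 (ltW _ _ l') c'.
have [? [] [e _]] := h' _ Pt; have [? [] [e' _]] := h' _ Rt; subst => //.
- by rewrite ltnn in l.
- by have := ltn_trans l l'; rewrite ltnn.
- by rewrite ltnn in l.
Qed.

Lemma transv_inj2 (K : finType) : inj2 (@transv K).
Proof. by move=> i j [e a] [f b] [-> -> ->]. Qed.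

Lemma square_inj2 (K : finZmodType) i j : i != j -> inj2 (@square K i j).
Proof.
move=> nij [u1 u2] [v1 v2] a b [] /= e <- ev.
have -> : u1 = v1 by case: u1 v1 e => [] [] // e; rewrite e eqxx in nij.
by split=> //; move: ev; case: u2 => // /oppr_inj.
Qed.

Lemma square_trace (K : finZmodType) (i j : 'I_4) (t : {set pt K}) :
  i != j -> #|t| = 3 -> cvd (code_fam (square i j) (skew_words K)) t ->
  [/\ cls_inj t, forall z, z \in t -> exists c a, z = inr (c, a) /\ (c.1 = i \/ c.1 = j),
      exists2 c, c.1 = i & exists a, inr (c, a) \in t,
      exists2 c, c.1 = j & exists a, inr (c, a) \in t &
      exists h a b, [/\ inr (h, false, a) \in t, inr (h, true, b) \in t & a != b]].
Proof.
move=> nij t3 [_ /imsetP[w wS ->] tw].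
have I4 : #|{: bool * bool}| = 4 by rewrite card_prod !card_bool.
have pI := @square_inj2 K i j nij.
have [[p q] uP] := code_trace pI I4 t3 tw.
split.
- move=> x y /(subsetP tw)/imsetP[u _ ->] /(subsetP tw)/imsetP[v _ ->] [].
  by case: u v => [u1 u2] [v1 v2] /= e <-; have -> : u1 = v1 by case: u1 v1 e => [] [] // e;
    rewrite e eqxx in nij.
- move=> z /(subsetP tw)/imsetP[u _ ->]; exists (if u.1 then j else i, u.2); eexists; split;
  first by [].
  by case: u.1; [right|left].
- have := uP (false, ~~ q); rewrite xpair_eqE.
  have -> : (~~ q == q) = false by case: (q).
  by rewrite andbF /square /= => h; exists (i, ~~ q) => //; eexists; exact: h.
- have := uP (true, ~~ q); rewrite xpair_eqE.
  have -> : (~~ q == q) = false by case: (q).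
  by rewrite andbF /square /= => h; exists (j, ~~ q) => //; eexists; exact: h.
have [s0 w1] : (\sum_i w i = 0 /\ w (false, false) + w (false, true) != 0)%R.
  by move: wS; rewrite !inE => /andP[/eqP].
have w2 : (w (true, false) + w (true, true) != 0)%R.
  apply: contraNneq w1 => e; rewrite -s0.
  have -> : (\sum_i w i = w (false, false) + w (false, true) + (w (true, false) + w (true, true)))%R.
    rewrite (bigD1 (false, false)) // (bigD1 (false, true)) // (bigD1 (true, false)) //
      (bigD1 (true, true)) //=.
    rewrite big1 ?addr0 ?addrA // => -[[] []] //.
  by rewrite e addr0.
(* The triple misses a point of group [p], so it contains both points of the other group. *)
exists (if ~~ p then j else i), (w (~~ p, false)), (- w (~~ p, true))%R.
have nu : (~~ p == p) = false by case: (p).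
have m e : square i j (~~ p, e) (w (~~ p, e)) \in t by rewrite uP xpair_eqE nu.
split; [exact: (m false)|exact: (m true)|].
by rewrite -addr_eq0; case: (p).
Qed.

Lemma square_fam_spec (K : finZmodType) (t : {set pt K}) :
  #|t| = 3 -> cvd (square_fam K) t ->
  [/\ spread_set t, cls_inj t,
      exists i j, forall z, z \in t -> exists c a, z = inr (c, a) /\ (c.1 = i \/ c.1 = j) &
      exists h a b, [/\ inr (h, false, a) \in t, inr (h, true, b) \in t & a != b]].
Proof.
move=> t3 /cvd_bigcup_if[[i j] /= lij c].
have nij : i != j by rewrite -val_eqE neq_ltn lij.
have [ti ij [c1 c1i [a at']] [c2 c2j [b bt]] h] := square_trace nij t3 c.
split=> //; last by exists i, j.
by apply: spread_of at' bt _; rewrite c1i c2j.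
Qed.

Lemma square_fam_uniq3 (K : finZmodType) : uniq3 (square_fam K).
Proof.
have ltW (i j : 'I_4) : i < j -> i != j by rewrite -val_eqE neq_ltn => ->.
apply: uniq3_bigcup_if => [[i j] /= /ltW nij|[i j] [i' j'] t t3 /= l l' c c'].
  apply: code_uniq3; [exact: square_inj2|by rewrite card_prod !card_bool|].
  move=> h x y; rewrite !inE => /andP[xZ _] /andP[yZ _]; apply: (zero_sum_cube _ _).2;
    by rewrite inE.
have [_ ij _ _ _] := square_trace (ltW _ _ l) t3 c.
have [_ _ [c1 ci' [a /ij[d1 [a1 [[<- _] h1]]]]] [c2 cj' [b /ij[d2 [b2 [[<- _] h2]]]]] _] :=
  square_trace (ltW _ _ l') t3 c'.
rewrite {}ci' in h1; rewrite {}cj' in h2; move: l l'.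
case: h1 h2 => -> [] ->; rewrite ?ltnn // => l l'.
by have := ltn_trans l l'; rewrite ltnn.
Qed.

Lemma transv_fam_spec (K : finType) (N : {set {ffun 'I_4 -> K}}) (t : {set pt K}) :
  #|t| = 3 -> cvd (transv_fam N) t ->
  cls_inj t /\ exists i (x : {ffun 'I_4 -> K}), x \in N /\
    forall j, j != i -> exists e, inr (j, e, x j) \in t.
Proof.
move=> t3 [_ /imsetP[w + ->] tw]; rewrite inE => /andP[_ wN].
have [i iP] := code_trace (@transv_inj2 K) (card_ord 4) t3 tw; split.
  move=> x y /(subsetP tw)/imsetP[u _ ->] /(subsetP tw)/imsetP[v _ ->].
  by rewrite /transv /= => -[->].
exists i, [ffun j => (w j).2]; split=> // j nji; exists (w j).1.
by have := iP j; rewrite nji ffunE.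
Qed.

Lemma transv_fam_uniq3 (K : finType) (Q N : {set {ffun 'I_4 -> K}}) D :
  near_cube Q N D -> uniq3 (transv_fam N).
Proof.
move=> nc; apply: code_uniq3; [exact: transv_inj2|exact: card_ord|].
move=> i x y; rewrite !inE => /andP[/eqP xe xN] /andP[/eqP ye yN] e.
apply: eqoff_eq (e) _; rewrite (surjective_pairing (x i)) (surjective_pairing (y i)); congr (_, _).
  have S : \big[addb/false]_(j | j != i) (x j).1 = \big[addb/false]_(j | j != i) (y j).1.
    by apply: eq_bigr => j nji; rewrite e.
  have ab (a b c : bool) : addb a c = false -> addb b c = false -> a = b by case: a b c => [] [] [].
  by move: xe ye; rewrite (bigD1 i) //= S => xe; rewrite (bigD1 i) //=; exact: ab.
suff /ffunP/(_ i) : [ffun j => (x j).2] = [ffun j => (y j).2] by rewrite !ffunE.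
by apply: (nc_uniq nc (i := i)) => // j nji; rewrite !ffunE e.
Qed.

Lemma hole_fam_spec (K : finType) (D : 'I_4 -> {set {ffun 'I_4 -> K}}) (t : {set pt K}) :
  #|t| = 3 -> cvd (hole_fam D) t ->
  [/\ spread_set t, cls_inj t &
     exists2 x, admissible D x (@cls K @: t) & forall z, z \in t -> z = phi x (cls z)].
Proof.
move=> t3 [c /imsetP[[x b]]]; rewrite inE /= => /andP[bC /admissibleP bx] -> tb {c}.
have [sb c3 xE] := phi_trace tb; rewrite t3 in c3.
split.
- have /(cand10_cvd c3) h : cvd cand10 (@cls K @: t) by exists b.
  by move=> i; have [_ /imsetP[z zt ->] zi] := h i; exists z.
- by move=> u v /xE {2}-> /xE {2}-> ->.
exists x => //; apply/admissibleP=> i h; apply: bx => j /h; exact: touches_sub.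
Qed.

(** The families follow a case division on triples: inside an extended group; otherwise with a
    repeated class; otherwise with two elements of [K] in one group; and finally triples carried by
    a word, [transv_fam] taking those on three groups off the holes and [hole_fam] the rest. *)
Definition sqs_blocks (K : finZmodType) S B (N : {set {ffun 'I_4 -> K}}) D : {set {set pt K}} :=
  fill_fam S :|: (link_fam B :|: (square_fam K :|: (transv_fam N :|: hole_fam D))).

Lemma cvdUE (T : finType) (B B' : {set {set T}}) t : cvd (B :|: B') t -> cvd B t \/ cvd B' t.
Proof. by case=> b; rewrite inE => /orP[] bB tb; [left|right]; exists b. Qed.

Lemma transv_spread (K : finType) (t : {set pt K}) i (x : {ffun 'I_4 -> K}) :
  (forall j, j != i -> exists e, inr (j, e, x j) \in t) -> spread_set t.
Proof.
move=> h; have [j [k [l]]] := four_ord i; rewrite /= !inE !negb_or !(eq_sym i).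
case/and3P=> /and3P[ji ki _] /andP[jk _] _.
by have [? jt] := h j ji; have [? kt] := h k ki; apply: spread_of jt kt jk.
Qed.

(** Each family has a signature that the later ones lack: not being spread, a repeated class, two
    elements of [K] in one group with only two groups met, and lastly a non-hole on three groups. *)
Lemma sqs_blocks_uniq3 (K : finZmodType) S B (Q N : {set {ffun 'I_4 -> K}}) D :
  uniq3 S -> bbd (fun x => x.1 == ord0) B -> near_cube Q N D -> uniq3 (sqs_blocks S B N D).
Proof.
move=> uS Bb nc; apply: uniq3U (fill_fam_uniq3 uS) _ _; last first.
  move=> t t3 tF tR; apply: (spread_not_filled _ tF).
  case/cvdUE: tR => [/(link_fam_spec Bb t3)[]//|/cvdUE[/(square_fam_spec t3)[]//|/cvdUE[]]].
    by case/(transv_fam_spec t3)=> _ [i [x [_ /transv_spread]]].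
  by case/(hole_fam_spec t3).
apply: uniq3U (link_fam_uniq3 Bb) _ _; last first.
  move=> t t3 /(link_fam_spec Bb t3)[_ nti] tR; apply: nti.
  case/cvdUE: tR => [/(square_fam_spec t3)[]//|/cvdUE[/(transv_fam_spec t3)[]//|]].
  by case/(hole_fam_spec t3).
apply: uniq3U (@square_fam_uniq3 K) _ _; last first.
  move=> t t3 /(square_fam_spec t3)[_ _ [i [j ij]] [h [a [b [ht bt nab]]]]] /cvdUE[].
    case/(transv_fam_spec t3)=> _ [i0 [w [_ wt]]].
    have mem k : k != i0 -> k = i \/ k = j.
      by move=> /wt[e /ij[c [a' [[<- _] h']]]].
    have [l [p [q]]] := four_ord i0; rewrite /= !inE !negb_or !(eq_sym i0).
    case/and3P=> /and3P[/mem hl /mem hp /mem hq] /andP[lp lq] /andP[pq _].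
    by case: hl hp hq lp lq pq => -> [] -> [] ->; rewrite ?eqxx.
  case/(hole_fam_spec t3)=> _ _ [x _ xE]; have := xE _ ht; have := xE _ bt => -[bE] [aE].
  by rewrite aE bE eqxx in nab.
apply: uniq3U (transv_fam_uniq3 nc) (hole_fam_uniq3 nc) _.
move=> t t3 /(transv_fam_spec t3)[_ [i [y [yN yt]]]] /(hole_fam_spec t3)[_ _ [x /admissibleP xo xE]].
have xD : x \in D i.
  apply: xo => j /yt[e jt]; apply/existsP; exists e; apply/imsetP.
  by exists (inr (j, e, y j)).
have: y \in D i.
  apply: nc_off xD; [exact: nc|move=> j /yt[e jt]].
  by have [] := xE _ jt.
by apply/negP; exact: nc_hole nc _ _ yN.
Qed.

Lemma link_cvd (K : finType) (B : {set {set 'I_2 * K}}) P R (t : {set pt K}) a a' b :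
  bbd (fun x => x.1 == ord0) B -> #|t| = 3 -> P.1 != R.1 ->
  inr (P, a) \in t -> inr (P, a') \in t -> inr (R, b) \in t -> a != a' ->
  cvd (link_fam B) t.
Proof.
move=> Bb t3 nPR at_ at' bt naa'.
have cov : forall u, u \in t -> [\/ u = inr (P, a), u = inr (P, a') | u = inr (R, b)].
  apply: set3_cover => //; apply/eqP => -[]; first by move/eqP; rewrite (negbTE naa').
    by move=> e; rewrite e eqxx in nPR.
  by move=> e; rewrite e eqxx in nPR.
(* The family contains each pair of classes in one orientation only, so both orders are treated at
   once. *)
have main (P' R' : 'I_4 * bool) :
  P'.1 < R'.1 -> (P', R') = (P, R) \/ (P', R') = (R, P) -> cvd (link_fam B) t.
  move=> l PR; apply: (@cvd_bigcup _ _ _ (P', R')); rewrite /= l.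
  have nPR' : P'.1 != R'.1 by rewrite -val_eqE neq_ltn l.
  have li := @link_inj K _ _ nPR'.
  have e : t = link P' R' @: (link P' R' @^-1: t).
    apply/setP=> z; apply/idP/imsetP => [zt|[y]]; last by rewrite inE => ? ->.
    have [k [x zE]] : exists k x, z = @link K P' R' (k, x).
      case: PR => -[-> ->]; case: (cov z zt) => ->;
      by [exists ord0; eexists; reflexivity|exists ord_max; eexists; reflexivity].
    by exists (k, x) => //; rewrite inE -zE.
  have t03 : #|link P' R' @^-1: t| = 3 by rewrite -(card_imset _ li) -e.
  rewrite e; case: Bb => _ _ Bc; apply/push_cvd/Bc => //.
  have [[x xt] [y yt]] : (exists x, inr (P', x) \in t) /\ (exists y, inr (R', y) \in t).
    by case: PR => -[-> ->]; split; [exists a|exists b|exists b|exists a].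
  by split; [exists (ord0, x)|exists (ord_max, y)]; rewrite ?inE.
have := nPR; rewrite -val_eqE neq_ltn => /orP[l|l].
  by apply: (main P R l); left.
by apply: (main R P l); right.
Qed.

(** The group not containing [u] keeps its nonzero sum under the zero-sum completion, and the zero
    total transfers this to the other group. *)
Lemma skew_ext (K : finZmodType) (u : bool * bool) (v : {ffun bool * bool -> K}) :
  (v (~~ u.1, false) + v (~~ u.1, true) != 0)%R ->
  exists2 w, w \in skew_words K & eqoff u v w.
Proof.
move=> nz; have [w wZ e] := (zero_sum_cube _ K).1 u v; exists w => //.
rewrite inE wZ /=; have : (w (~~ u.1, false) + w (~~ u.1, true) != 0)%R.
  by rewrite -!e //; case: (u) => [[] []].
case: (~~ u.1) => // nw; apply: contraNneq nw => w0; move: wZ; rewrite inE.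
rewrite (bigD1 (false, false)) // (bigD1 (false, true)) // (bigD1 (true, false)) //.
rewrite (bigD1 (true, true)) //= big1; last by case=> [[] []].
by rewrite addr0 addrA w0 add0r => /eqP->.
Qed.

Lemma square_cvd (K : finZmodType) (t : {set pt K}) h j f a b c : #|t| = 3 ->
  inr (h, false, a) \in t -> inr (h, true, b) \in t -> inr (j, f, c) \in t ->
  h != j -> a != b -> cvd (square_fam K) t.
Proof.
move=> t3 at_ bt ct nhj nab.
have cov : forall u, u \in t -> [\/ u = inr (h, false, a), u = inr (h, true, b) | u = inr (j, f, c)].
  apply: set3_cover => //; apply/eqP => -[] // e; move: nhj; by rewrite e eqxx.
pose s (e : bool) (x : K) : K := if e then (- x)%R else x.
have ss e x : s e (s e x) = x by rewrite /s; case: e; rewrite ?opprK.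
have main (i1 i2 : 'I_4) (p : bool) :
  i1 < i2 -> (if p then i2 else i1) = h -> (if p then i1 else i2) = j ->
    cvd (square_fam K) t.
  move=> l hE jE; apply: (@cvd_bigcup _ _ _ (i1, i2)); rewrite /= l.
  (* [p] marks the group [h]; the entry at [(~~ p, ~~ f)] is a filler for the point to be found. *)
  pose v : {ffun bool * bool -> K} :=
    [ffun u => s u.2 (if u.1 == p then (if u.2 then b else a) else c)].
  have vE u : square i1 i2 u (v u) =
     inr (if u.1 then i2 else i1, u.2, if u.1 == p then (if u.2 then b else a) else c).
    by rewrite /square ffunE; congr (inr (_, _, _)); exact: ss.
  have hp e : (if p then i2 else i1, e) = (h, e) by rewrite hE.
  have jp : (if ~~ p then i2 else i1) = j by rewrite -jE; case: (p).
  have np : (~~ p == p) = false by case: (p).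
  have [w wS e] : exists2 w, w \in skew_words K & eqoff (~~ p, ~~ f) v w.
    apply: skew_ext; rewrite /= negbK !ffunE /= eqxx /s subr_eq0; exact: nab.
  apply: (code_cvd (v := v)) wS e.
    apply/subsetP=> z /cov[] ->; apply/imsetP.
    - by exists (p, false) => //; rewrite vE /= eqxx hE.
    - by exists (p, true) => //; rewrite vE /= eqxx hE.
    - by exists (~~ p, f) => //; rewrite vE /= np jp.
  rewrite vE /= np jp; apply/negP=> /cov[] [].
  - by move=> e _ _; rewrite e eqxx in nhj.
  - by move=> e _ _; rewrite e eqxx in nhj.
  - by case: (f).
have := nhj; rewrite -val_eqE neq_ltn => /orP[l|l].
  exact: (main h j false).
exact: (main j h true).
Qed.

Lemma transv_cvd (K : finType) (Q N : {set {ffun 'I_4 -> K}}) D (t : {set pt K}) i x :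
  near_cube Q N D -> #|t| = 3 -> x \notin D i ->
  (forall j, j != i -> exists e, inr (j, e, x j) \in t) -> cvd (transv_fam N) t.
Proof.
move=> nc t3 nxD h; have [y yN exy] := nc_ext nc nxD.
(* Away from [i], the bit reads off from [t] which class is used in group [j]. *)
pose v : {ffun 'I_4 -> bool * K} := [ffun j => (inr (j, true, x j) \in t, x j)].
have vt j : j != i -> transv j (v j) \in t.
  move/h=> [e et]; rewrite /transv ffunE /=; case m: (inr (j, true, x j) \in t) => //.
  by case: e et => // et; rewrite et in m.
have te : t = [set transv j (v j) | j in [set~ i]].
  apply/esym/eqP; rewrite eqEcard; apply/andP; split.
    by apply/subsetP=> _ /imsetP[j + ->]; rewrite !inE; exact: vt.
  rewrite t3 card_imset ?cardsC1 ?card_ord //; exact: (blk_inj (@transv_inj2 K)).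
pose par := \big[addb/false]_(j | j != i) (v j).1.
(* The fourth point takes its class from parity and its element of [K] from the near cube. *)
pose w : {ffun 'I_4 -> bool * K} := [ffun j => if j == i then (par, y i) else v j].
apply: (code_cvd (v := v) (i := i) (w := w)).
- by rewrite te; apply/subsetP=> _ /imsetP[j _ ->]; apply/imsetP; exists j.
- rewrite te; apply/negP=> /imsetP[j]; rewrite !inE => nji /transv_inj2[e _].
  by rewrite e eqxx in nji.
- rewrite inE; apply/andP; split.
    rewrite (bigD1 i) //= ffunE eqxx /= -/par.
    suff -> : \big[addb/false]_(j | j != i) (w j).1 = par by rewrite addbb.
    by apply: eq_bigr => j /negbTE nji; rewrite ffunE nji.
  suff -> : [ffun j => (w j).2] = y by [].
  apply/ffunP=> j; rewrite !ffunE; case: eqVneq => [->//|nji] /=.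
  by rewrite ?ffunE /= exy.
by move=> j /negbTE nji; rewrite [RHS]ffunE nji.
Qed.

Lemma sqs_blocks_cvd (K : finZmodType) (S : {set {set bool + bool * K}}) (B : {set {set 'I_2 * K}})
    (Q N : {set {ffun 'I_4 -> K}}) D (t : {set pt K}) :
  (forall t0 : {set bool + bool * K}, #|t0| = 3 -> cvd S t0) ->
  bbd (fun x => x.1 == ord0) B -> near_cube Q N D -> #|t| = 3 -> cvd (sqs_blocks S B N D) t.
Proof.
move=> cS Bb nc t3; apply: cvdU.
have [/existsP[i /forall_inP ti]|/existsPn nt] :=
  boolP [exists i, [forall z in t, ~~ off_grp i (cls z)]].
  by left; exact: fill_cvd ti.
have sp : spread_set t.
  by move=> i; have /forall_inPn[z zt] := nt i; rewrite negbK; exists z.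
right; apply: cvdU.
have off i : exists j e c, inr (j, e, c) \in t /\ i != j.
  by have [[//|[[j e] c]] zt /= nji] := sp i; exists j, e, c; rewrite eq_sym.
have [/forall_inP ti|] := boolP [forall z in t, [forall u in t, (cls z == cls u) ==> (z == u)]];
  last first.
  case/forall_inPn=> z zt /forall_inPn[u ut]; rewrite negb_imply => /andP[/eqP e nzu]; left.
  case: z u e nzu zt ut => [?|[P a]] [?|[_ a']] //= [<-]; first by rewrite eqxx.
  move=> naa' at_ at'; have [j [f [c [ct nj]]]] := off P.1.
  apply: (link_cvd Bb t3 (P := P) (R := (j, f)) nj at_ at' ct).
  by apply: contraNneq naa' => ->.
have {}ti : cls_inj t.
  by move=> z u zt ut e; move/forall_inP: (ti z zt) => /(_ u ut); rewrite e eqxx => /eqP.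
right; apply: cvdU.
have [/existsP[i /existsP[a /existsP[b /and3P[at_ bt nab]]]]|inc] := boolP
    [exists i, exists a, exists b, [&& inr (i, false, a) \in t, inr (i, true, b) \in t & a != b]].
  left; have [j [f [c [ct nj]]]] := off i; exact: (square_cvd t3 at_ bt ct nj nab).
right; apply: cvdU.
(* Points of [t] in the same group now share their element of [K], so [t] spells a partial word;
   untouched groups get the default 0. *)
pose x : {ffun 'I_4 -> K} := [ffun j => odflt 0%R [pick a | [exists e, inr (j, e, a) \in t]]].
have xE z : z \in t -> z = phi x (cls z).
  case: z => [//|[[i e] a]] zt /=; congr (inr (_, _, _)); rewrite ffunE.
  case: pickP => [b /= /existsP[f bt]|/(_ a) /= /negbT/negP[]]; last by apply/existsP; exists e.
  have [ef|nef] := eqVneq e f.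
    by subst f; have := ti _ _ zt bt erefl => -[].
  apply/eqP; apply: contraNT inc => /= nab; apply/existsP; exists i.
  case: e f nef zt bt => [] [] //= _ at_ bt; apply/existsP.
    by exists b; apply/existsP; exists a; rewrite at_ bt eq_sym.
  by exists a; apply/existsP; exists b; rewrite at_ bt.
have c3 : #|@cls K @: t| = 3 by rewrite card_in_imset.
have [xok|/admissibleP nok] := boolP (admissible D x (@cls K @: t)).
  right; have -> : t = phi x @: (@cls K @: t).
    by rewrite -imset_comp -[LHS]imset_id; apply: eq_in_imset => z /xE.
  apply: hole_fam_cvd nc c3 _ xok => i; have [z zt zi] := sp i.
  by exists (cls z) => //; exact: imset_f.
(* Failure of admissibility gives a face whose three groups are all touched and on which [x] is not
   a hole. *)
left; have [i /andP[/forall_inP it nxi]] :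
  exists i, [forall (j | j != i), touches (@cls K @: t) j] && (x \notin D i).
  apply/existsP; apply: contraT => /existsPn h; case: nok => i it.
  by have := h i; rewrite negb_and negbK => /orP[/negP[]|//]; apply/forall_inP.
apply: (transv_cvd nc t3 nxi) => j nji; have /existsP[e /imsetP[z zt ez]] := it j nji.
by exists e; have := xE z zt; rewrite -ez /= => <-.
Qed.

(** * Relabelling and the two embeddings *)

Lemma push_cover (T T' : finType) (f : T -> T') (B : {set {set T}}) : bijective f ->
  (forall t : {set T}, #|t| = 3 -> cvd B t) -> forall t : {set T'}, #|t| = 3 -> cvd (push f B) t.
Proof.
move=> [g fK gK] c t t3.
have -> : t = f @: (g @: t) by rewrite -imset_comp (eq_imset _ gK) imset_id.
by apply/push_cvd/c; rewrite card_imset //; exact: can_inj gK.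
Qed.

Lemma halves (n m : nat) (g1 : {set 'I_n}) : #|g1| = m.+1 -> #|~: g1| = m.+1 ->
  exists2 f : 'I_n -> 'I_2 * 'I_m.+1, bijective f & forall x, ((f x).1 == ord0) = (x \in g1).
Proof.
move=> c1 c2; pose side (x : 'I_n) := if x \in g1 then g1 else ~: g1.
pose f (x : 'I_n) : 'I_2 * 'I_m.+1 :=
  (if x \in g1 then ord0 else ord_max, inord (index x (enum (side x)))).
have fE x : ((f x).1 == ord0) = (x \in g1) by rewrite /f; case: ifP.
exists f => //; apply: inj_card_bij; last first.
  by rewrite card_prod !card_ord mul2n -addnn -{1}c1 -c2 cardsC card_ord.
have ms x : x \in enum (side x) by rewrite mem_enum /side; case: ifPn => //; rewrite inE.
have is_ x : index x (enum (side x)) < m.+1.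
  have : index x (enum (side x)) < size (enum (side x)) by rewrite index_mem.
  by rewrite -cardE /side; case: ifP; rewrite ?c1 ?c2.
move=> x y fxy; have sxy : side x = side y by rewrite /side -!fE fxy.
have /(congr1 val) := congr1 snd fxy; rewrite /= !inordK // => e.
by rewrite -(nth_index x (ms x)) e sxy nth_index.
Qed.

(** The predicate [sz] treats both claims together: new blocks have size 4, and the filled groups
    inherit their sizes from [S]. *)
Lemma embedding (n : nat) (sz : nat -> Prop) (S : {set {set 'I_(2 * n + 2)}})
    (g1 : {set 'I_n}) (Bn : {set {set 'I_n}}) :
  2 < n -> sz 4 -> (forall b, b \in S -> sz #|b|) -> three_wise_once S -> is_3BBD g1 Bn ->
  exists S' : {set {set 'I_(8 * n + 2)}},
    ((forall b, b \in S' -> sz #|b|) /\ three_wise_once S') /\ embeds S S' /\ embeds Bn S'.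
Proof.
move=> n2 sz4 Ssz S3 bbdn.
have n4 := dvd4_3BBD n2 bbdn; have nc := nc_exists (ltnW (ltnW n2)) n4.
have Bb := bbd_of_3BBD bbdn; have c12 : #|g1| = #|~: g1| by case: bbdn.
have nE : n = #|g1| + #|g1| by rewrite {2}c12 cardsC card_ord.
have [m mE] : exists m, #|g1| = m.+1.
  by exists #|g1|.-1; rewrite prednK // lt0n; apply: contraTneq n2 => g0; rewrite nE g0.
have [f fb fs] := halves mE (etrans (esym c12) mE).
(* This set is at once the relabelled point set of [Bn], a class, and the group alphabet of the near
   cube. *)
pose K := ('I_2 * 'I_m.+1)%type.
have cK : #|{: K}| = n by rewrite card_prod !card_ord mul2n -addnn nE mE.
have {}Bb : bbd (fun x : K => x.1 == 0%R) (push f Bn) by exact: bbd_push fb fs Bb.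
have Db := bbd_double Bb.
set B := (_ :|: _) in Db.
have [Q [N [D ncD]]] := nc {: K} cK.
have [s sb] : exists s : 'I_(2 * n + 2) -> bool + bool * K, bijective s.
  by apply: card_bij; rewrite card_ord card_sum card_prod card_bool cK addnC.
have [u ub] : exists u : pt K -> 'I_(8 * n + 2), bijective u.
  apply: card_bij; rewrite card_ord card_sum !card_prod card_bool card_ord.
  by rewrite -(card_prod _ _) cK addnC.
have sS : uniq3 S by move=> t b b' t3; exact: once_uniq3 (S3 t t3).
have cS (t : {set _}) : #|t| = 3 -> cvd S t by move=> t3; exact: once_cvd (S3 t t3).
pose F := @sqs_blocks _ (push s S) B N D.
have Fsz b : b \in F -> sz #|b|.
  rewrite !inE => /orP[/bigcupP[i _ /imsetP[_ /imsetP[c cin ->] ->]]|].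
    by rewrite !card_imset; [exact: Ssz|exact: bij_inj|exact: fill_inj].
  move=> bF; suff -> : #|b| = 4 by [].
  case/or4P: bF => [/bigcupP[[P R] _]|/bigcupP[[i j] _]|/imsetP[w _ ->]|/hole_fam_card//].
  - case: ifP => [l|]; rewrite ?inE // => /imsetP[c cB ->].
    rewrite card_imset; first by case: Db => B4 _ _; exact: B4.
    by apply: link_inj; rewrite -val_eqE neq_ltn l.
  - case: ifP => [l|]; rewrite ?inE // => /imsetP[w _ ->].
    rewrite card_blk ?card_prod ?card_bool //.
    by apply: square_inj2; rewrite -val_eqE neq_ltn l.
  - by rewrite card_blk ?card_ord //; exact: transv_inj2.
have uF : uniq3 F.
  by apply: sqs_blocks_uniq3 ncD => //; apply: push_uniq3 => //; exact: bij_inj.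
have cF (t : {set _}) : #|t| = 3 -> cvd F t.
  by move=> t3; apply: sqs_blocks_cvd ncD t3 => //; exact: push_cover.
exists (push u F); split; [split|split].
- by move=> _ /imsetP[b bF ->]; rewrite card_imset; [exact: Fsz|exact: bij_inj].
- by apply: three_wise_onceI; [apply: push_uniq3 => //; exact: bij_inj|exact: push_cover].
- exists (u \o fill ord0 \o s); split.
    by apply: inj_comp (bij_inj sb); apply: inj_comp (bij_inj ub) _; exact: fill_inj.
  move=> b bS; rewrite imset_comp imset_comp; apply: imset_f; rewrite inE; apply/orP; left.
  by apply/bigcupP; exists ord0 => //; do 2 apply: imset_f.
(* [Bn] sits in the copy [(0, 0)] inside its double, which is placed on classes of two different
   groups. *)
pose P : 'I_4 * bool := (ord0, false); pose R : 'I_4 * bool := (ord_max, false).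
exists (u \o @link K P R \o @dbl 'I_m.+1 ord0 ord0 \o f); split.
  apply: inj_comp (bij_inj fb); apply: inj_comp; last by move=> [? ?] [? ?] [-> _ ->].
  by apply: inj_comp (bij_inj ub) _; exact: link_inj.
move=> b bB.
have -> : (u \o @link K P R \o @dbl 'I_m.+1 ord0 ord0 \o f) @: b =
    u @: (@link K P R @: (@dbl 'I_m.+1 ord0 ord0 @: (f @: b))) by rewrite -!imset_comp.
apply: imset_f; apply/setUP; right; apply/setUP; left.
apply/bigcupP; exists (P, R) => //; apply: imset_f; apply/setUP; left.
by apply/bigcupP; exists (ord0, ord0) => //; do 2 apply: imset_f.
Qed.

Theorem theorem3 (n : nat) : 75 < n -> ~~ odd n ->
  (forall (S : {set {set 'I_(2 * n + 2)}}) (g1 : {set 'I_n}) (Bn : {set {set 'I_n}}),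
     is_SQS S -> is_3BBD g1 Bn ->
     exists S' : {set {set 'I_(8 * n + 2)}},
       is_SQS S' /\ embeds S S' /\ embeds Bn S') /\
  (forall (S : {set {set 'I_(2 * n + 2)}}) (g1 : {set 'I_n}) (Bn : {set {set 'I_n}}),
     is_S346 S -> is_3BBD g1 Bn ->
     exists S' : {set {set 'I_(8 * n + 2)}},
       is_S346 S' /\ embeds S S' /\ embeds Bn S').
Proof.
move=> n75 _; have n2 : 2 < n by exact: leq_trans n75.
by split=> S g1 Bn [Ssz S3] b3; [apply: (embedding (sz := fun k => k = 4)) Ssz S3 b3|
  apply: (embedding (sz := fun k => k = 4 \/ k = 6)) Ssz S3 b3] => //; left.
Qed.
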